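(* Let $\theta<0$ and $\rho=0$, let $(W_t)_{t\ge 0}$ be a standard Brownian motion, and let $(X_t)$, $(V_t)$ be the solution of $dX_t=\theta X_t\,dt+dV_t$, $dV_t=\rho V_t\,dt+dW_t$ with $X_0=V_0=0$ (so that $V_t=W_t$). Let $\widehat\rho_T$ be the estimator defined in the context. Then, as $T\to\infty$, we have the convergence in distribution $$T\,\widehat\rho_T\longrightarrow\mathcal W,$$ where the limiting distribution $\mathcal W$ is that of $$\mathcal W=\frac{\int_0^1B_s\,dB_s}{\int_0^1B_s^2\,ds}=\frac{B_1^2-1}{2\int_0^1B_s^2\,ds},$$ with $(B_t)$ a standard Brownian motion.
   Context: For $T>0$, the estimator of $\theta$ is $$\widehat\theta_T=\frac{\int_0^T X_t\,dX_t}{\int_0^T X_t^2\,dt}=\frac{X_T^2-T}{2\int_0^T X_t^2\,dt}.$$ Put $\Sigma_t=\int_0^t X_s\,ds$, and for $0\le t\le T$ define the residuals $\widehat V_t=X_t-\widehat\theta_T\,\Sigma_t$ (these depend on $T$ through $\widehat\theta_T$). The estimator of $\rho$ is $$\widehat\rho_T=\frac{\widehat V_T^2-T}{2\int_0^T\widehat V_t^2\,dt}.$$ *)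

(* Defs.v *)
From HB Require Import structures.
From mathcomp Require Import all_boot all_order all_algebra.
From mathcomp Require Import all_classical all_reals all_analysis.

Set Implicit Arguments.
Unset Strict Implicit.
Unset Printing Implicit Defensive.

Import Order.TTheory GRing.Theory Num.Theory.
Import numFieldNormedType.Exports.

Local Open Scope classical_set_scope.
Local Open Scope ring_scope.

(* Processes are families indexed by the whole real line of which only the
   times t >= 0 are ever constrained or used. *)
Definition process d (Omega : measurableType d) (R : realType)
  (P : probability Omega R) := R -> {RV P >-> R}.

Definition sample_path d (Omega : measurableType d) (R : realType)
    (P : probability Omega R) (X : process P) (w : Omega) : R -> R :=
  fun t => X t w.

Definition continuous_paths d (Omega : measurableType d) (R : realType)
    (P : probability Omega R) (X : process P) :=
  forall w, {within `[0, +oo[, continuous (sample_path X w)}.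

Definition increment d (Omega : measurableType d) (R : realType)
    (P : probability Omega R) (X : process P) (s t : R) : Omega -> R :=
  fun w => X t w - X s w.

(* Letting some A i be the full space gives the product rule for every
   subfamily. *)
Definition mutually_independent d (Omega : measurableType d) (R : realType)
    (P : probability Omega R) (n : nat) (Y : 'I_n -> Omega -> R) :=
  forall A : 'I_n -> set R, (forall i, measurable (A i)) ->
    P (\bigcap_(i in [set: 'I_n]) (Y i @^-1` A i)) =
    (\prod_(i < n) P (Y i @^-1` A i))%E.

Record standard_brownian_motion d (Omega : measurableType d) (R : realType)
    (P : probability Omega R) (W : process P) : Prop := {
  sbm_start : {ae P, forall w, W 0 w = 0} ;
  sbm_continuous : continuous_paths W ;
  (* the second parameter of normal_prob is the standard deviation *)
  sbm_gaussian : forall s t : R, 0 <= s -> s < t ->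
    forall A : set R, measurable A ->
      P (increment W s t @^-1` A) = normal_prob 0 (Num.sqrt (t - s)) A ;
  sbm_independent : forall (n : nat) (t : nat -> R),
    0 <= t 0%N -> (forall i, t i < t i.+1) ->
    mutually_independent P (fun i : 'I_n => increment W (t i) (t i.+1)) }.

(* \int_0^t x_s ds *)
Definition time_integral (R : realType) (x : R -> R) (t : R) : R :=
  \int[@lebesgue_measure R]_(s in `[0, t]) x s.

(* dY_t = a Y_t dt + dZ_t with Y_0 = 0: the noise being additive, the integral
   form of the equation involves no stochastic integral. *)
Record solves_linear_sde d (Omega : measurableType d) (R : realType)
    (P : probability Omega R) (a : R) (Z Y : process P) : Prop := {
  sde_continuous : continuous_paths Y ;
  sde_start : {ae P, forall w, Y 0 w = 0} ;
  sde_equation : {ae P, forall w, forall t, 0 <= t ->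
    Y t w = Y 0 w + a * time_integral (sample_path Y w) t + increment Z 0 t w} }.

(* x stands for a sample path of X. By the Ito formula this is
   \int_0^T X_t dX_t / \int_0^T X_t ^ 2 dt for X driven by a standard Brownian
   motion and started at 0. *)
Definition theta_hat (R : realType) (x : R -> R) (T : R) : R :=
  (x T ^+ 2 - T) / (2 * time_integral (fun t => x t ^+ 2) T).

Definition V_hat (R : realType) (x : R -> R) (T t : R) : R :=
  x t - theta_hat x T * time_integral x t.

Definition rho_hat (R : realType) (x : R -> R) (T : R) : R :=
  (V_hat x T T ^+ 2 - T) / (2 * time_integral (fun t => V_hat x T t ^+ 2) T).

(* Convergence in distribution, as T tends to infinity, of the random
   variables Y T on (Omega, P) to the law of Z on (Omega', P'). *)
Definition cvg_in_distribution d (Omega : measurableType d)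
    d' (Omega' : measurableType d') (R : realType)
    (P : probability Omega R) (Y : R -> Omega -> R)
    (P' : probability Omega' R) (Z : Omega' -> R) : Prop :=
  [/\ forall T, 0 < T -> measurable_fun [set: Omega] (Y T),
      measurable_fun [set: Omega'] Z &
      forall f : R -> R, continuous f -> bounded_fun f ->
        ('E_P[f \o Y T])%E @[T --> +oo] --> ('E_P'[f \o Z])%E].

(* Main.v *)
Require Import Defs.
From HB Require Import structures.
From mathcomp Require Import all_boot all_order all_algebra.
From mathcomp Require Import all_classical all_reals all_analysis.
From mathcomp Require Import measurable_realfun.
From mathcomp Require Import ring lra.

Set Implicit Arguments.
Unset Strict Implicit.
Unset Printing Implicit Defensive.

Import Order.TTheory GRing.Theory Num.Theory.
Import numFieldNormedType.Exports.

Local Open Scope classical_set_scope.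
Local Open Scope ring_scope.

(** As [rho = 0], the path of [V] is that of [W], so [X = theta * Sigma + W]
    where [Sigma] is the time integral of [X].  Eliminating [Sigma] turns the
    residuals into an interpolation between noise and observation,

      [V_hat_t = (1 - c) * W_t + c * X_t]  with  [c = 1 - theta_hat / theta].

    The mean-reverting path [X] stays of order one while [W] is of order
    [sqrt T], so as soon as [c] tends to 0 in probability the residuals cannot
    be told from [W] at the diffusive scale.  With [U = W_T / sqrt T] and
    [D = T^-2 \int_0^T W^2], the statistic is [T * rho_hat = (p^2 - 1) / (2 q)]
    where [p - U] and [q - D] tend to 0 in probability.  The law of [(U, D)]
    does not depend on [T]: by Brownian scaling it is that of
    [(B_1, \int_0^1 B^2)], and [D > 0] almost surely.  Slutsky's lemma
    ([slutsky]) then gives the limit of [(U^2 - 1) / (2 D)].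

    The law of [(U, D)].  Both components are limits of sums over a mesh, and
    these sums are the values of a Markov chain whose noise is the sequence of
    rescaled increments, of law [N(0, 1/n)] whatever [T].  The law of such a
    chain is determined by that of its noise ([driven_chain_law]), and dominated
    convergence passes to the limit ([brownian_functional_law]).

    The consistency [c -> 0].  Put [I = \int_0^T X^2] and
    [M = (X_T^2 - T - 2 theta I) / 2], which is [\int_0^T X dW] by the Ito
    formula.  Then [c = - (M / T) / (theta I / T)], and it suffices that
    [E X_T^2 = O(1)] and [E M^2 = O(T)]: they give [I / T -> - 1 / (2 theta)] and
    [M / T -> 0] in probability.  Both bounds are obtained without a stochastic
    integral, from the Euler scheme of [X]: it carries a discrete version of [M]
    that is a martingale with explicit variance ([ou_second_moment],
    [ou_martingale_moment]), it converges along every path ([euler_cvg],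
    [euler_energy_cvg]), and Fatou's lemma with Chebyshev's inequality transfers
    the bounds ([fatou_chebyshev]). *)

(** * Centred Gaussian laws: scaling and moments *)

Section normal.
Context {R : realType}.
Notation mu := (@lebesgue_measure R).

(** The Gaussian law is defined through its density, so the latter is a version
    of its Radon-Nikodym derivative. *)
Lemma integral_normal_prob (s : R) (f : R -> \bar R) :
  (normal_prob 0 s).-integrable [set: R] f ->
  (\int[normal_prob 0 s]_x f x = \int[mu]_x (f x * (normal_pdf 0 s x)%:E))%E.
Proof.
move=> intf.
rewrite -(Radon_Nikodym_change_of_variables (normal_prob_dominates 0 s))//=.
apply: ae_eq_integral => //.
- apply: emeasurable_funM => //; first exact: (measurable_int _ intf).
  apply: (measurable_int mu).
  by apply: Radon_Nikodym_integrable; exact: normal_prob_dominates.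
- apply: emeasurable_funM => //=; first exact: (measurable_int _ intf).
  by apply/measurable_EFinP; exact: measurable_normal_pdf.
- apply: ae_eqe_mul2l => /=.
  rewrite Radon_NikodymE//=; first exact: normal_prob_dominates.
  move=> dom; case: cid => /= h [h1 h2 h3].
  apply: integral_ae_eq => //=.
  + by apply/measurable_EFinP; exact: measurable_normal_pdf.
  + by move=> E _ mE; rewrite -h3.
Qed.

Lemma ge0_integral_normal_prob (s : R) (f : R -> \bar R) :
  measurable_fun [set: R] f -> (forall x, 0 <= f x)%E ->
  (\int[normal_prob 0 s]_x f x = \int[mu]_x (f x * (normal_pdf 0 s x)%:E))%E.
Proof.
move=> mf f0.
have dom := normal_prob_dominates 0 s.
rewrite -(@Radon_Nikodym_SigmaFinite.change_of_variables _ _ _ _ _ dom)//=.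
apply: ae_eq_integral => //.
- apply: emeasurable_funM => //; apply: (measurable_int mu).
  exact: Radon_Nikodym_SigmaFinite.f_integrable.
- apply: emeasurable_funM => //=.
  by apply/measurable_EFinP; exact: measurable_normal_pdf.
- apply: ae_eqe_mul2l => /=.
  apply: integral_ae_eq => //=.
  + exact: Radon_Nikodym_SigmaFinite.f_integrable.
  + by apply/measurable_EFinP; exact: measurable_normal_pdf.
  + by move=> E _ mE; rewrite -Radon_Nikodym_SigmaFinite.f_integral.
Qed.

Lemma integrable_normal_prob (s : R) (f : R -> R) :
  mu.-integrable [set: R] (fun x => (f x * normal_pdf 0 s x)%:E) ->
  measurable_fun [set: R] f ->
  (normal_prob 0 s).-integrable [set: R] (EFin \o f).
Proof.
move=> /integrableP[_ intf] mf; apply/integrableP; split.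
  exact/measurable_EFinP.
rewrite ge0_integral_normal_prob//; last first.
  by apply/measurableT_comp => //; exact/measurable_EFinP.
apply: le_lt_trans intf; rewrite le_eqVlt; apply/orP; left; apply/eqP.
apply: eq_integral => x _ /=.
by rewrite -EFinM normrM (ger0_norm (normal_pdf_ge0 _ _ _)).
Qed.

(** Both sides, divided by [c], are measures that agree on intervals. *)
Lemma lebesgue_measure_scale (c : R) (A : set R) : 0 < c -> measurable A ->
  mu ((fun x : measurableTypeR R => x / c : measurableTypeR R) @^-1` A) =
  (c%:E * mu A)%E.
Proof.
move=> c0 mA.
pose phi : measurableTypeR R -> measurableTypeR R := fun x => x / c.
have mphi : measurable_fun [set: measurableTypeR R] phi by exact: measurable_funM.
have ci0 : 0 <= c^-1 by rewrite invr_ge0 ltW.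
pose m := mscale (NngNum ci0) (pushforward mu phi).
rewrite (_ : mu A = m mphi A).
  by rewrite /m /mscale/= /pushforward muleA -EFinM divff ?gt_eqF// mul1e.
apply: lebesgue_measure_unique => //= _ [[a b]] _ <-.
rewrite /m /mscale/= /pushforward.
rewrite (_ : phi @^-1` `]a, b] = `](a * c), (b * c)]%classic); last first.
  by apply/seteqP; split => x /=; rewrite !in_itv/= ltr_pdivlMr// ler_pdivrMr.
rewrite !lebesgue_measure_itv/= !lte_fin ltr_pM2r//.
case: ifP => // _; last by rewrite mule0.
by rewrite -!EFinD -EFinM -mulrBl mulrCA mulVf ?mulr1// gt_eqF.
Qed.

(** This is what makes the rescaled Brownian increments insensitive to the
    horizon. *)
Lemma normal_prob_scale (c s : R) (A : set R) : 0 < c -> 0 < s -> measurable A ->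
  normal_prob 0 s ((fun x => x / c) @^-1` A) = normal_prob 0 (s / c) A.
Proof.
move=> c0 s0 mA; rewrite /normal_prob.
pose phi : measurableTypeR R -> measurableTypeR R := fun x => x / c.
have mphi : measurable_fun [set: measurableTypeR R] phi by exact: measurable_funM.
have c0' : 0 <= c by rewrite ltW.
have pdfE x : normal_pdf 0 s x = c^-1 * normal_pdf 0 (s / c) (x / c).
  rewrite !normal_pdfE ?gt_eqF ?divr_gt0// mulrA; congr (_ * _).
    rewrite /normal_peak -invfM; congr (_^-1).
    have -> : s ^+ 2 * pi *+ 2 = c ^+ 2 * ((s / c) ^+ 2 * pi *+ 2).
      by rewrite !mulr2n; field; rewrite gt_eqF.
    by rewrite sqrtrM ?sqr_ge0// sqrtr_sqr ger0_norm.
  rewrite /normal_fun !subr0; congr expR.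
  rewrite !mulr2n; field.
  by rewrite gt_eqF//= gt_eqF// addr_gt0// exprn_gt0.
rewrite (eq_integral
  (fun x => c^-1%:E * (normal_pdf 0 (s / c) (phi x))%:E)%E); last first.
  by move=> x _; rewrite pdfE EFinM.
have mpdf : measurable_fun A (fun x => (normal_pdf 0 (s / c) x)%:E).
  by apply/measurable_EFinP/measurable_funTS; exact: measurable_normal_pdf.
transitivity (c^-1%:E *
    \int[pushforward mu phi]_(y in A) (normal_pdf 0 (s / c) y)%:E)%E.
  rewrite ge0_integral_pushforward//=; last first.
    by move=> *; rewrite lee_fin normal_pdf_ge0.
  rewrite ge0_integralZl//=; first by rewrite -[X in measurable X]setTI; exact: mphi.
  - apply/measurable_EFinP/measurable_funTS/measurableT_comp => //.
    exact: measurable_normal_pdf.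
  - by move=> *; rewrite lee_fin normal_pdf_ge0.
  - by rewrite lee_fin invr_ge0.
rewrite (eq_measure_integral (mscale (NngNum c0') mu)); last first.
  by move=> B mB _; rewrite [LHS]lebesgue_measure_scale.
rewrite ge0_integral_mscale//=; last by move=> *; rewrite lee_fin normal_pdf_ge0.
by rewrite muleA -EFinM mulVf ?mul1e// gt_eqF.
Qed.

End normal.

Section moments.
Context {R : realType}.
Notation mu := (@lebesgue_measure R).

(** Doubling the standard deviation absorbs a polynomial of degree four.  This
    gives at once the integrability of such polynomials and the decay of the
    boundary terms in [integral_normal_stein]. *)
Lemma normal_pdf_quartic_le (s : R) : 0 < s -> exists2 C : R, 0 <= C &
  forall x, (1 + x ^+ 4) * normal_pdf 0 s x <= C * normal_pdf 0 (2 * s) x.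
Proof.
move=> s0.
have s20 : 0 < 2 * s by rewrite mulr_gt0.
exists (normal_peak s / normal_peak (2 * s) * (1 + 4 * (8 * s ^+ 2 / 3) ^+ 2)).
  apply: mulr_ge0; first by rewrite divr_ge0 ?normal_peak_ge0.
  by apply: addr_ge0 => //; apply: mulr_ge0 => //; exact: sqr_ge0.
move=> x; rewrite !normal_pdfE ?gt_eqF//.
have p0 : 0 < normal_peak (2 * s) by rewrite normal_peak_gt0 ?gt_eqF.
rewrite mulrA (mulrC _ (normal_peak s)) -!mulrA ler_wpM2l ?normal_peak_ge0//.
rewrite [leRHS](_ : _ = (1 + 4 * (8 * s ^+ 2 / 3) ^+ 2) *
    normal_fun 0 (2 * s) x); last first.
  by field; rewrite gt_eqF.
pose y := 3 / 8 * x ^+ 2 / s ^+ 2.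
have y0 : 0 <= y by rewrite /y divr_ge0 ?sqr_ge0// mulr_ge0 ?sqr_ge0// divr_ge0.
have -> : normal_fun 0 s x = normal_fun 0 (2 * s) x * expR (- y).
  rewrite /normal_fun -expRD; congr expR; rewrite /y !mulr2n; field.
  by rewrite gt_eqF//= !gt_eqF// addr_gt0// exprn_gt0.
rewrite mulrCA mulrC ler_wpM2r ?expR_ge0// expRN ler_pdivrMr ?expR_gt0//.
have e1 : 1 <= expR y by rewrite -expR0 ler_expR.
(* [expR y] is the square of [expR (y / 2) >= 1 + y / 2]. *)
have e2 : y ^+ 2 <= 4 * expR y.
  have h := expR_ge1Dx (y / 2).
  have -> : expR y = expR (y / 2) ^+ 2.
    by rewrite -expRM_natl; congr expR; rewrite /=; field.
  have : (1 + y / 2) ^+ 2 <= expR (y / 2) ^+ 2.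
    by rewrite lerXn2r// ?nnegrE ?expR_ge0//; lra.
  nra.
have -> : x ^+ 4 = (8 * s ^+ 2 / 3) ^+ 2 * y ^+ 2.
  by rewrite /y; field; rewrite gt_eqF.
have h3 : 0 <= (8 * s ^+ 2 / 3) ^+ 2 by rewrite sqr_ge0.
have := ler_wpM2l h3 e2; lra.
Qed.

Lemma norm_quartic_le (a0 a1 a2 a3 a4 : R) (x : R) :
  `|a0 + a1 * x + a2 * x ^+ 2 + a3 * x ^+ 3 + a4 * x ^+ 4| <=
  (`|a0| + `|a1| + `|a2| + `|a3| + `|a4|) * (1 + x ^+ 4).
Proof.
have h k : (k <= 4)%N -> `|x| ^+ k <= 1 + x ^+ 4.
  move=> k4.
  have -> : x ^+ 4 = `|x| ^+ 4 by rewrite -normrX ger0_norm// exprn_even_ge0.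
  have [x1|/ltW x1] := leP `|x| 1.
    by apply: (@le_trans _ _ 1); [rewrite exprn_ile1 | rewrite lerDl exprn_ge0].
  apply: (@le_trans _ _ (`|x| ^+ 4)); last by rewrite lerDr.
  by rewrite ler_weXn2l.
rewrite !mulrDl.
do 3 (apply: le_trans (ler_normD _ _) (lerD _ _);
  last by rewrite normrM normrX ler_wpM2l// h).
apply: le_trans (ler_normD _ _) (lerD _ _); last first.
  by rewrite normrM ler_wpM2l//; apply: (h 1%N).
by rewrite -[leLHS]mulr1 ler_wpM2l//; apply: (h 0%N).
Qed.

Lemma integrable_quartic_normal_pdf (s a0 a1 a2 a3 a4 : R) : 0 < s ->
  mu.-integrable [set: R] (fun x => ((a0 + a1 * x + a2 * x ^+ 2 + a3 * x ^+ 3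
    + a4 * x ^+ 4) * normal_pdf 0 s x)%:E).
Proof.
move=> s0; have [C C0 hC] := normal_pdf_quartic_le s0.
set K := `|a0| + `|a1| + `|a2| + `|a3| + `|a4|.
have K0 : 0 <= K by rewrite !addr_ge0.
apply: (@le_integrable _ _ _ mu _ _ _
  (fun x => (K * C)%:E * (normal_pdf 0 (2 * s) x)%:E)%E) => //.
- apply/measurable_EFinP; apply: measurable_funM; last exact: measurable_normal_pdf.
  do 3 (apply: measurable_funD;
    last by apply: measurable_funM => //; exact: measurable_funX).
  by apply: measurable_funD => //; exact: measurable_funM.
- move=> x _ /=; rewrite lee_fin normrM (ger0_norm (normal_pdf_ge0 _ _ _)).
  rewrite [leRHS]ger0_norm; last by rewrite !mulr_ge0 ?normal_pdf_ge0.
  apply: (@le_trans _ _ (K * (1 + x ^+ 4) * normal_pdf 0 s x)).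
    by rewrite ler_wpM2r ?normal_pdf_ge0// norm_quartic_le.
  by rewrite -!mulrA ler_wpM2l.
- apply: integrableZl => //; exact: integrable_normal_pdf.
Qed.

Lemma is_derive_normal_pdf (s x : R) : 0 < s ->
  is_derive x 1 (normal_pdf 0 s) (- (x / s ^+ 2) * normal_pdf 0 s x).
Proof.
move=> s0; rewrite normal_pdfE ?gt_eqF// /normal_fun.
set p := normal_peak s.
have -> : (fun y : R => p * expR (- (y - 0) ^+ 2 / (s ^+ 2 *+ 2))) =
   (fun y => p * expR ((s ^+ 2 *+ 2)^-1 * - (y ^+ 2))).
  by apply/funext => y; rewrite subr0 mulrC (mulrC _ (- _)) mulrC.
apply: is_derive_eq.
rewrite /GRing.scale/= subr0 !mulr2n.
have -> : expR (- x ^+ 2 / (s ^+ 2 + s ^+ 2)) = expR ((s ^+ 2 + s ^+ 2)^-1 * - x ^+ 2).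
  by rewrite mulrC.
field.
by rewrite gt_eqF//= gt_eqF// addr_gt0// exprn_gt0.
Qed.

(** As the density satisfies [phi' = - x phi / s^2], the integrand is the
    derivative of [(b0 + b1 x + b2 x^2 + b3 x^3) phi]. *)
Lemma integral_normal_stein (s b0 b1 b2 b3 : R) : 0 < s ->
  (\int[mu]_x ((b1 + (2 * b2 - b0 / s ^+ 2) * x + (3 * b3 - b1 / s ^+ 2) * x ^+ 2
     + (- b2 / s ^+ 2) * x ^+ 3 + (- b3 / s ^+ 2) * x ^+ 4)
    * normal_pdf 0 s x)%:E)%E = 0%E.
Proof.
move=> s0.
pose F x := (b0 + b1 * x + b2 * x ^+ 2 + b3 * x ^+ 3) * normal_pdf 0 s x.
pose g x := (b1 + (2 * b2 - b0 / s ^+ 2) * x + (3 * b3 - b1 / s ^+ 2) * x ^+ 2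
     + (- b2 / s ^+ 2) * x ^+ 3 + (- b3 / s ^+ 2) * x ^+ 4) * normal_pdf 0 s x.
have dF (x : R) : is_derive x 1 F (g x).
  have h := is_derive_normal_pdf x s0.
  apply: is_derive_eq; rewrite /GRing.scale/= /g; field.
  by rewrite gt_eqF.
have cF : continuous F.
  by move=> x; apply: differentiable_continuous; apply/derivable1_diffP; have [] := dF x.
have cg : continuous g.
  move=> x; rewrite /g; apply: cvgM; last by apply: continuous_normal_pdf; rewrite gt_eqF.
  do 3 (apply: cvgD; last by apply: cvgM; [exact: cvg_cst|exact: exprn_continuous]).
  by apply: cvgD; [exact: cvg_cst|apply: cvgM; [exact: cvg_cst|exact: cvg_id]].
have intg : mu.-integrable [set: R] (EFin \o g) by exact: integrable_quartic_normal_pdf.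
pose I n : set R := `[- n.+1%:R, n.+1%:R]%classic.
have FTC n : (\int[mu]_(x in I n) (g x)%:E = (F n.+1%:R - F (- n.+1%:R)%R)%:E)%E.
  rewrite EFinB; apply: continuous_FTC2.
  - by rewrite (@lt_trans _ _ 0)// ?oppr_lt0.
  - exact: continuous_subspaceT.
  - split.
    + by move=> x _; have [] := dF x.
    + by apply: cvg_at_right_filter; exact: cF.
    + by apply: cvg_at_left_filter; exact: cF.
  - by move=> x _; rewrite derive1E; have [_ ->] := dF x.
have [D D0 hD] : exists2 D, 0 <= D & forall x, x != 0 -> `|F x| <= D / `|x|.
  have [C C0 hC] := normal_pdf_quartic_le s0.
  pose K : R := `|0 : R| + `|b0| + `|b1| + `|b2| + `|b3|.
  have K0 : 0 <= K by rewrite !addr_ge0.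
  exists (K * (C * normal_peak (2 * s))); first by rewrite !mulr_ge0 ?normal_peak_ge0.
  move=> x x0; rewrite ler_pdivlMr ?normr_gt0// -normrM /F.
  rewrite [X in `|X|](_ : _ = (0 + b0 * x + b1 * x ^+ 2 + b2 * x ^+ 3 + b3 * x ^+ 4)
    * normal_pdf 0 s x); last by ring.
  rewrite normrM (ger0_norm (normal_pdf_ge0 _ _ _)).
  apply: (@le_trans _ _ (K * (1 + x ^+ 4) * normal_pdf 0 s x)).
    by rewrite ler_wpM2r ?normal_pdf_ge0// norm_quartic_le.
  rewrite -mulrA ler_wpM2l// (le_trans (hC x))// ler_wpM2l//.
  by apply: normal_pdf_ub; rewrite mulf_neq0 ?gt_eqF.
have F0 : (F n.+1%:R - F (- n.+1%:R)) @[n --> \oo] --> (0 : R).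
  have h n : `|F n.+1%:R - F (- n.+1%:R)| <= (D + D) * n.+1%:R^-1.
    rewrite mulrDl (le_trans (ler_normB _ _))// lerD//.
      by rewrite (le_trans (hD _ _)) ?pnatr_eq0// ger0_norm.
    by rewrite (le_trans (hD _ _)) ?oppr_eq0 ?pnatr_eq0// normrN ger0_norm.
  apply/cvgr0Pnorm_le => /= e e0.
  have : (D + D) * n.+1%:R^-1 @[n --> \oo] --> (D + D) * 0.
    by apply: cvgMr; exact: cvg_harmonic.
  rewrite mulr0 => /cvgr0Pnorm_le /(_ e e0); apply: filterS => n hn.
  by rewrite (le_trans (h n))// (le_trans (ler_norm _)).
have lim1 : (\int[mu]_(x in I n) (g x)%:E)%E @[n --> \oo] --> (\int[mu]_x (g x)%:E)%E.
  under eq_fun do rewrite integral_mkcond.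
  have := @dominated_convergence _ _ _ mu setT measurableT
    (fun n => (EFin \o g) \_ (I n)) (EFin \o g) (fun x => `|(g x)%:E|%E).
  case => //.
  - move=> n; apply/(measurable_restrictT _ _).1; first exact: measurable_itv.
    apply: measurable_funTS; apply/measurable_EFinP; exact: continuous_measurable_fun.
  - by apply/measurable_EFinP; exact: continuous_measurable_fun.
  - apply: aeW => x _; apply: cvg_near_cst.
    exists (Num.truncn `|x|) => // n /= hn.
    rewrite patchE mem_set// /I /= in_itv/= -ler_norml.
    by rewrite ltW// (lt_le_trans (truncnS_gt _))// ler_nat ltnS.
  - exact: integrable_abse.
  - apply: aeW => x n _; rewrite patchE; case: ifP => // _.
    by rewrite abse0.
have lim2 : (F n.+1%:R - F (- n.+1%:R))%:E @[n --> \oo] --> (\int[mu]_x (g x)%:E)%E.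
  by under eq_fun do rewrite -FTC.
apply: (cvg_unique _ lim2) => //.
by apply: cvg_EFin F0; exact: nearW.
Qed.

(** Once its mean is subtracted, a quartic has the form [q' - x q / s^2] with a
    cubic [q], so that [integral_normal_stein] applies. *)
Lemma integral_normal_prob_quartic (s a0 a1 a2 a3 a4 : R) : 0 < s ->
  (\int[normal_prob 0 s]_x (a0 + a1 * x + a2 * x ^+ 2 + a3 * x ^+ 3
    + a4 * x ^+ 4)%:E = (a0 + a2 * s ^+ 2 + 3 * a4 * s ^+ 4)%:E)%E.
Proof.
move=> s0.
have mq : measurable_fun [set: R] (fun x : R => a0 + a1 * x + a2 * x ^+ 2 + a3 * x ^+ 3
    + a4 * x ^+ 4).
  do 3 (apply: measurable_funD;
    last by apply: measurable_funM => //; exact: measurable_funX).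
  by apply: measurable_funD => //; exact: measurable_funM.
rewrite integral_normal_prob; last first.
  apply: integrable_normal_prob => //; exact: integrable_quartic_normal_pdf.
pose m := a0 + a2 * s ^+ 2 + 3 * a4 * s ^+ 4.
(* Coefficients of [q], solved from the top degree down; the constant term of
   the equation then forces the value of [m]. *)
pose b3 := - s ^+ 2 * a4; pose b2 := - s ^+ 2 * a3.
pose b1 := s ^+ 2 * (3 * b3 - a2); pose b0 := s ^+ 2 * (2 * b2 - a1).
transitivity (\int[mu]_x (m%:E * (normal_pdf 0 s x)%:E + ((b1 + (2 * b2 - b0 / s ^+ 2) * x
    + (3 * b3 - b1 / s ^+ 2) * x ^+ 2 + (- b2 / s ^+ 2) * x ^+ 3
    + (- b3 / s ^+ 2) * x ^+ 4) * normal_pdf 0 s x)%:E))%E.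
  apply: eq_integral => x _; rewrite -!EFinM -EFinD -mulrDl; congr (_ * _)%:E.
  by rewrite /m /b0 /b1 /b2 /b3; field; rewrite gt_eqF.
rewrite integralD//; last 2 first.
- by apply: integrableZl => //; exact: integrable_normal_pdf.
- exact: integrable_quartic_normal_pdf.
rewrite integral_normal_stein// adde0 integralZl//; last exact: integrable_normal_pdf.
by rewrite integral_normal_pdf mule1.
Qed.

End moments.

(** * Markov chains driven by independent noise *)

Section driven_chain.
Context {d dS : measure_display} {Omega : measurableType d} {S : measurableType dS}.
Context {R : realType}.

Fixpoint driven_chain (phi : S * R -> S) (z0 : S) (e : nat -> Omega -> R) (n : nat)
    (w : Omega) : S :=
  if n is m.+1 then phi (driven_chain phi z0 e m w, e m w) else z0.

Variable P : probability Omega R.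
Variables (phi : S * R -> S) (z0 : S) (e : nat -> Omega -> R).
Hypotheses (mphi : measurable_fun [set: S * R] phi).
Hypothesis (me : forall n, measurable_fun [set: Omega] (e n)).
Hypothesis indep_e : forall n, mutually_independent P (fun i : 'I_n => e i).

Local Notation Z := (driven_chain phi z0 e).

Lemma measurable_driven_chain n : measurable_fun [set: Omega] (Z n).
Proof.
elim: n => [|n ih] /=; first exact: measurable_cst.
by apply: measurableT_comp => //; exact: measurable_fun_pair.
Qed.

Definition future (B : nat -> set R) (n p : nat) : set Omega :=
  [set w | forall k, (n <= k < p)%N -> B k (e k w)].

Let futureE B n p : future B n p =
  \bigcap_(i in [set: 'I_p]) (e i @^-1` (if (i < n)%N then setT else B i)).
Proof.
apply/seteqP; split => w /= h.
- by move=> i _ /=; case: ltnP => // ni; apply: h; rewrite ni ltn_ord.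
- move=> k /andP[nk kp]; have /= := h (Ordinal kp) I.
  by rewrite ltnNge nk.
Qed.

Lemma measurable_future B n p : (forall k, measurable (B k)) ->
  measurable (future B n p).
Proof.
move=> mB; rewrite futureE; apply: fin_bigcap_measurable => //= i _.
rewrite -[X in measurable X]setTI; apply: me => //.
by case: ifP => _; [exact: measurableT|exact: mB].
Qed.

Lemma futureS B n p : (n < p)%N ->
  future B n p = e n @^-1` B n `&` future B n.+1 p.
Proof.
move=> np; apply/seteqP; split => w /=.
- move=> h; split; first by apply: h; rewrite leqnn.
  by move=> k /andP[/ltnW nk kp]; apply: h; rewrite nk.
- case=> hn h k /andP[nk kp]; move: nk; rewrite leq_eqVlt => /predU1P[<-//|nk].
  by apply: h; rewrite nk.
Qed.

Lemma prob_futureS B n p : (forall k, measurable (B k)) -> (n < p)%N ->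
  P (future B n p) = (P (e n @^-1` B n) * P (future B n.+1 p))%E.
Proof.
move=> mB np; rewrite !futureE !indep_e; last 2 first.
- by move=> i; case: ifP => _; [exact: measurableT|exact: mB].
- by move=> i; case: ifP => _; [exact: measurableT|exact: mB].
rewrite (bigD1 (Ordinal np))//= [in RHS](bigD1 (Ordinal np))//= ltnn ltnSn.
rewrite preimage_setT probability_setT mul1e; congr (_ * _)%E.
apply: eq_bigr => i; rewrite -val_eqE/= => /negbTE ni.
by rewrite [in RHS]ltnS [in RHS]leq_eqVlt ni.
Qed.

Let pairZ n w := (Z n w, e n w).

Let measurable_pairZ n : measurable_fun [set: Omega] (pairZ n).
Proof. by apply: measurable_fun_pair => //; exact: measurable_driven_chain. Qed.

Let Zrv n : {RV P >-> S} :=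
  HB.pack (Z n) (isMeasurableFun.Build _ _ _ _ (Z n) (measurable_driven_chain n)).
Let pairrv n : {RV P >-> (S * R)%type} :=
  HB.pack (pairZ n) (isMeasurableFun.Build _ _ _ _ (pairZ n) (measurable_pairZ n)).
Let erv n : {RV P >-> R} :=
  HB.pack (e n) (isMeasurableFun.Build _ _ _ _ (e n) (me n)).

(** The state at time [n] is a function of the noise before [n].  The induction
    step extends independence from [Z n] to [phi (Z n, e n)]: the two sides, as
    functions of a set [C] that contains [(Z n, e n)], are measures, equal on
    rectangles by the induction hypothesis, hence equal on [phi @^-1` A]. *)
Lemma driven_chain_indep n p A B : (n <= p)%N -> measurable A ->
    (forall k, measurable (B k)) ->
  P (Z n @^-1` A `&` future B n p) = (P (Z n @^-1` A) * P (future B n p))%E.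
Proof.
elim: n p A B => [|n ih] p A B np mA mB.
  have [z0A|z0A] := pselect (A z0).
    rewrite (_ : Z 0 @^-1` A = setT) ?setTI ?probability_setT ?mul1e//.
    by apply/seteqP; split.
  rewrite (_ : Z 0 @^-1` A = set0) ?set0I ?measure0 ?mul0e//.
  by apply/seteqP; split.
have mF := measurable_future n.+1 p mB.
have k0 : 0 <= fine (P (future B n.+1 p)) by rewrite fine_ge0.
pose kap := NngNum k0.
have kapE : kap%:num%:E = P (future B n.+1 p) by rewrite fineK// fin_num_measure.
pose D1 := distribution P (Zrv n).
pose D2 := mscale kap (distribution P (erv n)).
pose m1 := [the {measure set (S * R) -> \bar R} of pushforward (mrestr P mF) (pairZ n)].
pose m2 := mscale kap (distribution P (pairrv n)).
have rect q C D : (n < q)%N -> measurable C -> measurable D ->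
    P ((pairZ n @^-1` (C `*` D)) `&` future B n.+1 q) =
    (P (Z n @^-1` C) * (P (e n @^-1` D) * P (future B n.+1 q)))%E.
  move=> nq mC mD; pose B' k := if k == n then D else B k.
  (* The constraint on [e n] is read as one more constraint on the future. *)
  have mB' k : measurable (B' k) by rewrite /B'; case: ifP.
  have FE : future B n.+1 q = future B' n.+1 q.
    apply/seteqP; split => w /= h k nk;
      by have := h k nk; rewrite /B' gtn_eqF//; case/andP: nk.
  rewrite FE -[D in P (e n @^-1` D)](_ : B' n = D); last by rewrite /B' eqxx.
  rewrite -prob_futureS// -ih//; last exact: ltnW.
  rewrite (futureS B' nq) setIA; congr (P (_ `&` _)).
  by rewrite /B' eqxx.
have E1 : forall X, measurable X -> (D1 \x D2)%E X = m1 (measurable_pairZ n) X.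
  apply: product_measure_unique => C D mC mD.
  rewrite /m1/= /pushforward /mrestr rect//.
  by rewrite /D1 /D2 /distribution/= /mscale/= /pushforward kapE (muleC _ (P (e n @^-1` D))).
have E2 : forall X, measurable X -> (D1 \x D2)%E X = m2 X.
  apply: product_measure_unique => C D mC mD.
  rewrite /m2 /D1 /D2 /= /mscale/= /distribution /pushforward kapE.
have := rect n.+1 C D (ltnSn n) mC mD.
  have -> : future B n.+1 n.+1 = setT.
    by apply/seteqP; split => // w _ k /andP[nk]; rewrite ltnNge nk.
  by rewrite setIT probability_setT mule1 => ->; rewrite muleCA.
have mphiA : measurable (phi @^-1` A).
  by rewrite -[X in measurable X]setTI; exact: mphi.
transitivity (m1 (measurable_pairZ n) (phi @^-1` A)); first by [].
by rewrite -E1// E2// /m2/= /mscale/= kapE muleC.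
Qed.

Lemma driven_chain_step n C : measurable C ->
  (distribution P (Zrv n) \x distribution P (erv n))%E C =
  P ((fun w => (Z n w, e n w)) @^-1` C).
Proof.
move=> mC; rewrite -[RHS]/(distribution P (pairrv n) C).
apply: product_measure_unique => // A D mA mD.
pose B (k : nat) := D.
have futE : future B n n.+1 = e n @^-1` D.
  apply/seteqP; split => w /=; first by apply; rewrite leqnn ltnSn.
  by move=> h k; rewrite ltnS -eqn_leq => /eqP <-.
have := @driven_chain_indep n n.+1 A B (leqnSn n) mA (fun=> mD).
by rewrite futE.
Qed.

(** Conditioning on the past.  Restricting to nonnegative [G] keeps the second
    moments of the Euler scheme free of integrability questions. *)
Lemma ge0_integral_driven_chain n (nu : probability (measurableTypeR R) R)
    (G : S * R -> \bar R) :
  (forall A, measurable A -> P (e n @^-1` A) = nu A) ->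
  measurable_fun [set: S * R] G -> (forall x, 0 <= G x)%E ->
  (\int[P]_w G (Z n w, e n w) = \int[P]_w \int[nu]_y G (Z n w, y))%E.
Proof.
move=> e_nu mG G0.
rewrite -[LHS](@ge0_integral_distribution _ _ _ _ _ P (pairrv n))//.
rewrite (eq_measure_integral
  (distribution P (Zrv n) \x distribution P (erv n))%E); last first.
  by move=> C mC _; rewrite -[LHS]driven_chain_step.
rewrite fubini_tonelli1// ge0_integral_distribution//; last 2 first.
- exact: measurable_fun_fubini_tonelli_F.
- by move=> y; apply: integral_ge0.
apply: eq_integral => w _; rewrite /fubini_F/=.
pose idR : measurableTypeR R -> R := idfun.
have midR : measurable_fun [set: measurableTypeR R] idR.
  by move=> _ A mA; rewrite setTI.
have mGw : measurable_fun [set: R] (fun y => G (Z n w, y)).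
  by apply: measurableT_comp => //; exact: measurable_fun_pair.
transitivity (\int[pushforward nu idR]_y G (Z n w, y))%E.
  by apply: eq_measure_integral => A mA _; exact: e_nu.
by rewrite ge0_integral_pushforward.
Qed.

End driven_chain.

(** One step pushes the product of the law of the state and that of the noise
    forward by [phi], so the laws agree by induction. *)
Lemma driven_chain_law {d d' dS : measure_display} {Omega : measurableType d}
    {Omega' : measurableType d'} {S : measurableType dS} {R : realType}
    (P : probability Omega R) (P' : probability Omega' R)
    (phi : S * R -> S) (z0 : S) (e : nat -> Omega -> R) (e' : nat -> Omega' -> R) :
  measurable_fun [set: S * R] phi ->
  (forall n, measurable_fun [set: Omega] (e n)) ->
  (forall n, measurable_fun [set: Omega'] (e' n)) ->
  (forall n, mutually_independent P (fun i : 'I_n => e i)) ->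
  (forall n, mutually_independent P' (fun i : 'I_n => e' i)) ->
  (forall n A, measurable A -> P (e n @^-1` A) = P' (e' n @^-1` A)) ->
  forall n A, measurable A ->
  P (driven_chain phi z0 e n @^-1` A) = P' (driven_chain phi z0 e' n @^-1` A).
Proof.
move=> mphi me me' ie ie' ee'; elim=> [|n ih] A mA.
  have [z0A|z0A] := pselect (A z0).
    rewrite (_ : driven_chain phi z0 e 0 @^-1` A = setT); last by apply/seteqP; split.
    rewrite (_ : driven_chain phi z0 e' 0 @^-1` A = setT); last by apply/seteqP; split.
    by rewrite !probability_setT.
  rewrite (_ : driven_chain phi z0 e 0 @^-1` A = set0); last by apply/seteqP; split.
  rewrite (_ : driven_chain phi z0 e' 0 @^-1` A = set0); last by apply/seteqP; split.
  by rewrite !measure0.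
have mphiA : measurable (phi @^-1` A).
  by rewrite -[X in measurable X]setTI; exact: mphi.
transitivity (P ((fun w => (driven_chain phi z0 e n w, e n w)) @^-1`
  (phi @^-1` A))); first by [].
rewrite -(driven_chain_step z0 mphi me ie n mphiA).
transitivity (P' ((fun w => (driven_chain phi z0 e' n w, e' n w)) @^-1`
  (phi @^-1` A))); last by [].
rewrite -(driven_chain_step z0 mphi me' ie' n mphiA).
apply: product_measure_unique => // C D mC mD.
rewrite /= product_measure1E//.
transitivity (P' (driven_chain phi z0 e' n @^-1` C) * P' (e' n @^-1` D))%E; first by [].
by rewrite -ih// -ee'.
Qed.

Lemma driven_chain_integral_eq {d d' dS : measure_display} {Omega : measurableType d}
    {Omega' : measurableType d'} {S : measurableType dS} {R : realType}
    (P : probability Omega R) (P' : probability Omega' R)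
    (phi : S * R -> S) (z0 : S) (e : nat -> Omega -> R) (e' : nat -> Omega' -> R)
    (n : nat) (f : S -> R) (K : R):
  measurable_fun [set: S * R] phi ->
  (forall n, measurable_fun [set: Omega] (e n)) ->
  (forall n, measurable_fun [set: Omega'] (e' n)) ->
  (forall n, mutually_independent P (fun i : 'I_n => e i)) ->
  (forall n, mutually_independent P' (fun i : 'I_n => e' i)) ->
  (forall n A, measurable A -> P (e n @^-1` A) = P' (e' n @^-1` A)) ->
  measurable_fun [set: S] f -> (forall x, `|f x| <= K) ->
  (\int[P]_w (f (driven_chain phi z0 e n w))%:E =
  \int[P']_w (f (driven_chain phi z0 e' n w))%:E)%E.
Proof.
move=> mphi me me' ie ie' ee' mf fK.
have mZ := measurable_driven_chain z0 mphi me n.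
have mZ' := measurable_driven_chain z0 mphi me' n.
pose Z : {RV P >-> S} :=
  HB.pack (driven_chain phi z0 e n) (isMeasurableFun.Build _ _ _ _ _ mZ).
pose Z' : {RV P' >-> S} :=
  HB.pack (driven_chain phi z0 e' n) (isMeasurableFun.Build _ _ _ _ _ mZ').
have mEf : measurable_fun [set: S] (EFin \o f) by exact/measurable_EFinP.
have bint dd (T : measurableType dd) (Q : probability T R) (Y : {RV Q >-> S}) :
    Q.-integrable [set: T] ((EFin \o f) \o Y).
  apply: (@le_integrable _ _ _ Q _ _ _ (EFin \o cst K)) => //.
  - exact: measurableT_comp.
  - move=> w _ /=; rewrite lee_fin (le_trans (fK _))// ler_norm//.
  - exact: finite_measure_integrable_cst.
rewrite -[LHS](@integral_distribution _ _ _ _ _ P Z (EFin \o f))//.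
rewrite -[RHS](@integral_distribution _ _ _ _ _ P' Z' (EFin \o f))//.
apply: eq_measure_integral => A mA _.
exact: (driven_chain_law z0 mphi me me' ie ie' ee' n mA).
Qed.

(** * Time integrals along a mesh *)

Section path_analysis.
Context {R : realType}.
Notation mu := (@lebesgue_measure R).
Implicit Types (x y : R -> R) (T : R).

(** Heine's theorem, with only one of the two points confined to the segment. *)
Lemma uniformly_continuous_segment y (a b e : R) : continuous y -> 0 < e ->
  exists2 dlt, 0 < dlt & forall s t, a <= s <= b -> `|s - t| < dlt ->
    `|y s - y t| < e.
Proof.
move=> cy e0.
have := (compact_near_coveringP `[a, b]%classic).1 (@segment_compact R a b).
move=> /(_ R (0^'+) (fun dlt s => forall t, `|s - t| < dlt -> `|y s - y t| < e) _).
have cov : forall z, `[a, b]%classic z -> \forall z' \near z & dlt \near (0 : R)^'+,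
    forall t, `|z' - t| < dlt -> `|y z' - y t| < e.
  move=> z _.
  have e20 : 0 < e / 2 by rewrite divr_gt0.
  have /cvgrPdist_lt /(_ _ e20) := cy z.
  case/nbhs_ballP => r /= r0 hr.
  have r20 : 0 < r / 2 by rewrite divr_gt0.
  exists (ball z (r / 2), [set dlt | dlt < r / 2]) => /=.
    split; first exact: nbhsx_ballx.
    by apply: nbhs_right_lt.
  move=> [z' dl] /= [zz' dlr] t z't.
  have h1 : `|y z - y z'| < e / 2.
    apply: hr; rewrite /ball/= in zz' *.
    by rewrite (lt_le_trans zz')// ler_pdivrMr// ler_pMr// ler1n.
  have h2 : `|y z - y t| < e / 2.
    apply: hr; rewrite /ball/= in zz' *.
    rewrite -(subrKA z') (le_lt_trans (ler_normD _ _))//.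
    by rewrite [ltRHS]splitr ltrD// (lt_trans z't).
  rewrite -(subrKA (y z)) (le_lt_trans (ler_normD _ _))//.
  by rewrite [ltRHS]splitr ltrD// distrC.
move=> /(_ cov) => near_dlt.
have [dl [dl0 hdl]] := filter_ex (filterI (nbhs_right_gt (0 : R)) near_dlt).
exists dl => // s t sab; apply: hdl.
by rewrite /= in_itv/=.
Qed.

(** Sample paths are constrained at nonnegative times only.  Freezing them
    before time 0 yields functions that are continuous on the whole line. *)
Lemma continuous_extend x : (forall b, {within `[0, b], continuous x}) ->
  continuous (fun t : R => x (Num.max 0 t)).
Proof.
move=> cx t.
have t1 : t < `|t| + 1 by rewrite (le_lt_trans (ler_norm _))// ltrDl.
have b0 : 0 <= `|t| + 1 by rewrite addr_ge0.
have /subspace_continuousP := cx (`|t| + 1).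
have At : `[0, (`|t| + 1)]%classic (Num.max 0 t).
  by rewrite /= in_itv/= le_max lexx/= ge_max b0/= ltW.
move=> /(_ _ At) h U /h /= hU.
have cmax : (fun t : R => Num.max 0 t) s @[s --> t] --> Num.max 0 t.
  by apply: continuous_max; [exact: cvg_cst|exact: cvg_id].
have hm : \forall s \near t, Num.max 0 s \in `[0, (`|t| + 1)] ->
  U (x (Num.max 0 s)) := cmax _ hU.
have hb : \forall s \near t, s < `|t| + 1 by exact: lt_nbhsl.
suff : \forall s \near t, U (x (Num.max 0 s)) by [].
near=> s; apply: (near hm s) => //.
rewrite /= in_itv/= le_max lexx/= ge_max b0/=.
by rewrite ltW//; apply: (near hb s).
Unshelve. all: end_near. Qed.

Lemma continuous_square y : continuous y -> continuous (fun t => y t ^+ 2).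
Proof.
move=> cy t; apply: (@continuous_comp _ _ _ y (fun z : R => z ^+ 2)).
  exact: cy.
exact: exprn_continuous.
Qed.

Lemma integrable_continuous y (a b : R) : continuous y ->
  mu.-integrable `[a, b] (EFin \o y).
Proof.
move=> cy; apply: continuous_compact_integrable; first exact: segment_compact.
exact: continuous_subspaceT.
Qed.

Lemma time_integralB y (s t : R) : continuous y -> 0 <= s -> s <= t ->
  time_integral y t - time_integral y s = \int[mu]_(u in `]s, t]) y u.
Proof.
move=> cy s0 st; apply: Rintegral_itvB; rewrite ?bnd_simp//.
exact: integrable_continuous.
Qed.

Lemma time_integral_increment y (s t c e : R) : continuous y -> 0 <= s -> s <= t ->
  (forall u, s <= u <= t -> `|c - y u| <= e) ->
  `|(t - s) * c - (time_integral y t - time_integral y s)| <= e * (t - s).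
Proof.
move=> cy s0 st h; rewrite time_integralB//.
have mst : fine (mu `]s, t]) = t - s.
  rewrite lebesgue_measure_itv/= lte_fin; case: ltP => //= ts.
  by apply/eqP; rewrite eq_sym subr_eq0 eq_le ts st.
have ic (k : R) : mu.-integrable `]s, t] (EFin \o cst k).
  have := @integrable_continuous (cst k) s t (@cst_continuous _ _ k).
  by apply: integrableS => //; exact: subset_itv_oc_cc.
have iy : mu.-integrable `]s, t] (EFin \o y).
  have := @integrable_continuous y s t cy.
  by apply: integrableS => //; exact: subset_itv_oc_cc.
rewrite -[X in X * c]mst mulrC -Rintegral_cst// -RintegralB//; last exact: ic.
have icy : mu.-integrable `]s, t] (EFin \o (fun u => c - y u)).
  rewrite (_ : _ \o _ = (EFin \o cst c) \- (EFin \o y))%E//.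
  exact: integrableB.
apply: (le_trans (le_normr_Rintegral _ icy)) => //.
rewrite -mst -Rintegral_cst//. apply: le_Rintegral => //.
- have := integrable_abse icy; exact.
- exact: ic.
- by move=> u /=; rewrite in_itv/= => /andP[su ut]; apply: h; rewrite ltW.
Qed.

Lemma time_integral0 y : time_integral y 0 = 0.
Proof. by rewrite /time_integral set_itv1 Rintegral_set1. Qed.

Definition mesh T (n : nat) : R := T / n.+1%:R.

Lemma mesh_gt0 T n : 0 < T -> 0 < mesh T n.
Proof. by move=> T0; rewrite divr_gt0. Qed.

Lemma mesh_ge0 T n : 0 < T -> 0 <= mesh T n.
Proof. by move=> T0; rewrite ltW ?mesh_gt0. Qed.

Lemma meshM T n : n.+1%:R * mesh T n = T.
Proof. by rewrite mulrC divfK. Qed.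

Lemma meshM_le T n i : 0 < T -> (i <= n.+1)%N -> i%:R * mesh T n <= T.
Proof.
by move=> T0 ni; rewrite -[leRHS](meshM T n) ler_wpM2r ?mesh_ge0// ler_nat.
Qed.

Lemma mesh_step T n i : i.+1%:R * mesh T n - i%:R * mesh T n = mesh T n.
Proof. by rewrite -mulrBl -natrB ?leqnSn// subSnn mul1r. Qed.

Lemma mesh_cvg0 T : mesh T n @[n --> \oo] --> 0.
Proof.
rewrite -[X in _ --> X](mulr0 T); apply: cvgMr; exact: cvg_harmonic.
Qed.

(** Uniformity in [i] is what makes local errors summable, both for Riemann sums
    and for the Euler scheme. *)
Lemma time_integral_mesh y T e : continuous y -> 0 < T -> 0 < e ->
  \forall n \near \oo, forall i, (i < n.+1)%N ->
  `|mesh T n * y (i%:R * mesh T n) - (time_integral y (i.+1%:R * mesh T n)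
    - time_integral y (i%:R * mesh T n))| <= e * mesh T n.
Proof.
move=> cy T0 e0.
have [dl dl0 hdl] := @uniformly_continuous_segment y 0 T e cy e0.
have /cvgr0Pnorm_lt /(_ _ dl0) := mesh_cvg0 T; apply: filterS => n.
rewrite ger0_norm ?mesh_ge0// => hn i ni.
have h0 := mesh_ge0 n T0.
have step := mesh_step T n i.
have iM : 0 <= i%:R * mesh T n by rewrite mulr_ge0.
rewrite -{1 5}step; apply: time_integral_increment => //.
  by rewrite -subr_ge0 step.
move=> u /andP[iu ui]; apply/ltW/hdl.
  by rewrite iM meshM_le// ltnW.
rewrite distrC ger0_norm ?subr_ge0//; apply: le_lt_trans hn.
by rewrite -[leRHS]step lerD2r.
Qed.

Lemma riemann_sum_cvg y T : continuous y -> 0 < T ->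
  mesh T n * \sum_(i < n.+1) y (i%:R * mesh T n) @[n --> \oo] --> time_integral y T.
Proof.
move=> cy T0; apply/cvgrPdist_le => e e0.
have eT : 0 < e / T by rewrite divr_gt0.
apply: filterS (time_integral_mesh cy T0 eT) => n hn.
have -> : time_integral y T = \sum_(i < n.+1) (time_integral y (i.+1%:R * mesh T n)
    - time_integral y (i%:R * mesh T n)).
  rewrite -(big_mkord xpredT (fun i => time_integral y (i.+1%:R * mesh T n)
    - time_integral y (i%:R * mesh T n))).
  rewrite (@telescope_sumr _ 0 n.+1 (fun i => time_integral y (i%:R * mesh T n)))//.
  by rewrite mul0r time_integral0 subr0 meshM.
rewrite mulr_sumr -sumrB (le_trans (ler_norm_sum _ _ _))//.
apply: (@le_trans _ _ (\sum_(i < n.+1) (e / T * mesh T n))).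
  by apply: ler_sum => i _; rewrite distrC hn.
rewrite sumr_const card_ord -mulr_natl mulrCA meshM divfK// gt_eqF//.
Qed.

Lemma time_integral_ge0 y T : (forall t, 0 <= y t) -> 0 <= time_integral y T.
Proof. by move=> y0; apply: Rintegral_ge0. Qed.

Lemma time_integral_gt0 y T : continuous y -> (forall t, 0 <= y t) -> 0 < T ->
  0 < y T -> 0 < time_integral y T.
Proof.
move=> cy y0 T0 yT.
have y20 : 0 < y T / 2 by rewrite divr_gt0.
have [dl dl0 hdl] := @uniformly_continuous_segment y 0 T _ cy y20.
pose s := Num.max 0 (T - dl / 2).
have s0 : 0 <= s by rewrite le_max lexx.
have sT : s < T by rewrite gt_max T0 ltrBlDr ltrDl divr_gt0.
have hs u : s <= u <= T -> y T / 2 <= y u.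
  move=> /andP[su uT].
  have : `|y T - y u| < y T / 2.
    apply: hdl; first by rewrite lexx ltW.
    rewrite ger0_norm ?subr_ge0//.
    have : T - dl / 2 <= u by apply: le_trans su; rewrite le_max lexx orbT.
    by lra.
  by rewrite ltr_norml => /andP[]; lra.
have Ts0 : 0 < (T - s) * (y T / 2) by rewrite mulr_gt0// subr_gt0.
apply: (lt_le_trans Ts0).
have isT z : continuous z -> mu.-integrable `]s, T] (EFin \o z).
  move=> cz; have := @integrable_continuous z s T cz.
  by apply: integrableS => //; exact: subset_itv_oc_cc.
apply: (@le_trans _ _ (time_integral y T - time_integral y s)); last first.
  by rewrite gerBl time_integral_ge0.
rewrite time_integralB//; last exact: ltW.
have <- : fine (mu `]s, T]) = T - s by rewrite lebesgue_measure_itv/= lte_fin sT.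
rewrite mulrC -Rintegral_cst//. apply: le_Rintegral => //.
- by apply: isT => z; exact: cst_continuous.
- exact: isT.
- by move=> u /=; rewrite in_itv/= => /andP[su uT]; apply: hs; rewrite ltW.
Qed.

Lemma continuous_time_integral y : continuous y ->
  continuous (fun t : R => time_integral y (Num.max 0 t)).
Proof.
move=> cy; apply: continuous_extend => b.
have [b0|b0] := leP 0 b.
  by apply: parameterized_integral_continuous => //; exact: integrable_continuous.
by rewrite set_itv_ge ?bnd_simp -?ltNge//; exact: continuous_subspace0.
Qed.

End path_analysis.

Lemma time_integral_extend {R : realType} (x y : R -> R) (t : R) :
  (forall s, 0 <= s -> x s = y s) -> time_integral x t = time_integral y t.
Proof.
move=> xy; apply: eq_Rintegral => s; rewrite inE/= in_itv/= => /andP[s0 _].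
exact: xy.
Qed.

Section measurable_time_integral.
Context {d : measure_display} {Omega : measurableType d} {R : realType}.

(** The integral is a pointwise limit of Riemann sums. *)
Lemma measurable_time_integral (Y : R -> Omega -> R) (T : R) : 0 <= T ->
  (forall t, 0 <= t -> measurable_fun [set: Omega] (Y t)) ->
  (forall w, continuous (fun t : R => Y (Num.max 0 t) w)) ->
  measurable_fun [set: Omega] (fun w => time_integral (fun t => Y t w) T).
Proof.
rewrite le_eqVlt => /predU1P[<-|T0] mY cY.
  by under eq_fun do rewrite time_integral0; exact: measurable_cst.
apply: (@measurable_fun_cvg _ _ _ _
  (fun n w => mesh T n * \sum_(i < n.+1) Y (i%:R * mesh T n) w)).
- move=> n; apply: measurable_funM => //; apply: measurable_sum => i.
  by apply: mY; rewrite mulr_ge0// mesh_ge0.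
- move=> w _; have := riemann_sum_cvg (cY w) T0.
  rewrite (@time_integral_extend _ _ (fun t => Y t w)); last first.
    by move=> s s0; rewrite max_r.
  rewrite (_ : (fun n => _) =
    (fun n => mesh T n * \sum_(i < n.+1) Y (i%:R * mesh T n) w))//.
  apply/funext => n; congr (_ * _).
  by apply: eq_bigr => i _; rewrite max_r// mulr_ge0// mesh_ge0.
Qed.

End measurable_time_integral.

Section time_integral_algebra.
Context {R : realType}.
Implicit Types x y : R -> R.

Lemma time_integral_quadratic x y (a b T : R) : continuous x -> continuous y ->
  time_integral (fun t => (a * x t + b * y t) ^+ 2) T =
  a ^+ 2 * time_integral (fun t => x t ^+ 2) T
  + 2 * a * b * time_integral (fun t => x t * y t) T
  + b ^+ 2 * time_integral (fun t => y t ^+ 2) T.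
Proof.
move=> cx cy.
have cx2 := continuous_square cx; have cy2 := continuous_square cy.
have cxy : continuous (fun t => x t * y t) by move=> t; exact: (cvgM (cx t) (cy t)).
have cZ (k : R) (z : R -> R) : continuous z -> continuous (fun t => k * z t).
  by move=> cz t; exact: (cvgM (cvg_cst k) (cz t)).
rewrite /time_integral -!RintegralZl//; [|exact: integrable_continuous..].
rewrite -RintegralD//; [|by apply: integrable_continuous; exact: cZ..].
rewrite -RintegralD//; last 2 first.
- apply: integrable_continuous => t; exact: (cvgD (cZ _ _ cx2 t) (cZ _ _ cxy t)).
- by apply: integrable_continuous; exact: cZ.
by apply: eq_Rintegral => t _; ring.
Qed.

(** Pointwise [2 |x y| <= x^2 + y^2]. *)
Lemma time_integral_product_le x y (T : R) : continuous x -> continuous y ->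
  `|time_integral (fun t => x t * y t) T| <=
  time_integral (fun t => x t ^+ 2) T + time_integral (fun t => y t ^+ 2) T.
Proof.
move=> cx cy.
have cx2 := continuous_square cx; have cy2 := continuous_square cy.
have cxy : continuous (fun t => x t * y t) by move=> t; exact: (cvgM (cx t) (cy t)).
have ixy := integrable_continuous 0 T cxy.
rewrite /time_integral -RintegralD//; [|exact: integrable_continuous..].
apply: (le_trans (le_normr_Rintegral _ ixy)) => //.
apply: le_Rintegral => //.
- exact: (integrable_abse ixy).
- by apply: integrable_continuous => t; exact: (cvgD (cx2 t) (cy2 t)).
- move=> t _; rewrite normrM.
  have := sqr_ge0 (`|x t| - `|y t|).
  rewrite sqrrB -[x t ^+ 2]real_normK ?num_real// -[y t ^+ 2]real_normK ?num_real//.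
  rewrite -mulr_natr; have := normr_ge0 (x t); have := normr_ge0 (y t); nra.
Qed.

End time_integral_algebra.

(** * The rescaled Brownian path *)

Lemma continuous_extended_path {d : measure_display} {Omega : measurableType d}
    {R : realType} (P : probability Omega R) (X : process P) (w : Omega) :
  continuous_paths X -> continuous (fun t : R => X (Num.max 0 t) w).
Proof.
move=> cX; apply: (@continuous_extend R (sample_path X w)) => b.
have := cX w; apply: continuous_subspaceW => s /=.
by rewrite !in_itv/= => /andP[->].
Qed.

Section brownian_grid.
Context {d : measure_display} {Omega : measurableType d} {R : realType}.
Variables (P : probability Omega R) (W : process P).
Hypothesis bmW : standard_brownian_motion W.
Variable T : R.
Hypothesis T0 : 0 < T.

Definition grid_increment (n i : nat) : Omega -> R :=
  increment W (i%:R * mesh T n) (i.+1%:R * mesh T n).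

Lemma measurable_increment (s t : R) : measurable_fun [set: Omega] (increment W s t).
Proof. by apply: measurable_funB; exact: measurable_funP. Qed.

Lemma measurable_grid_increment n i : measurable_fun [set: Omega] (grid_increment n i).
Proof. exact: measurable_increment. Qed.

Lemma grid_increment_indep n m :
  mutually_independent P (fun i : 'I_m => grid_increment n i).
Proof.
apply: (sbm_independent bmW (t := fun i => i%:R * mesh T n)) => [|i].
  by rewrite mul0r.
by rewrite ltr_pM2r ?mesh_gt0// ltr_nat.
Qed.

Lemma grid_increment_law n i A : measurable A ->
  P (grid_increment n i @^-1` A) = normal_prob 0 (Num.sqrt (mesh T n)) A.
Proof.
move=> mA.
have s0 : 0 <= i%:R * mesh T n by rewrite mulr_ge0 ?mesh_ge0.
have st : i%:R * mesh T n < i.+1%:R * mesh T n.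
  by rewrite ltr_pM2r ?mesh_gt0// ltr_nat.
by rewrite (sbm_gaussian bmW s0 st mA) mesh_step.
Qed.

Lemma sum_grid_increment n k w :
  \sum_(i < k) grid_increment n i w = increment W 0 (k%:R * mesh T n) w.
Proof.
rewrite -(big_mkord xpredT (fun i => grid_increment n i w)).
rewrite (@telescope_sumr _ 0 k (fun i => W (i%:R * mesh T n) w))//.
by rewrite mul0r.
Qed.

Definition scaled_increment n i : Omega -> R := fun w => grid_increment n i w / Num.sqrt T.

Lemma measurable_scaled_increment n i : measurable_fun [set: Omega] (scaled_increment n i).
Proof. by apply: measurable_funM => //; exact: measurable_grid_increment. Qed.

Let mscale_pre (A : set R) : measurable A ->
  measurable ((fun x : R => x / Num.sqrt T) @^-1` A).
Proof.
move=> mA; rewrite -[X in measurable X]setTI.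
have mdiv : measurable_fun [set: R] (fun x : R => x / Num.sqrt T).
  exact: measurable_funM.
exact: mdiv.
Qed.

Lemma scaled_increment_indep n m :
  mutually_independent P (fun i : 'I_m => scaled_increment n i).
Proof.
move=> A mA; have := @grid_increment_indep n m (fun i => (fun x => x / Num.sqrt T) @^-1` A i).
by apply => i; exact: mscale_pre.
Qed.

(** The variance [T / n.+1] of an increment over the mesh, divided by [T], no
    longer depends on [T]. *)
Lemma scaled_increment_law n i A : measurable A ->
  P (scaled_increment n i @^-1` A) = normal_prob 0 (Num.sqrt n.+1%:R^-1) A.
Proof.
move=> mA.
have sT0 : 0 < Num.sqrt T by rewrite sqrtr_gt0.
have sm0 : 0 < Num.sqrt (mesh T n) by rewrite sqrtr_gt0 mesh_gt0.
have <- : Num.sqrt (mesh T n) / Num.sqrt T = Num.sqrt n.+1%:R^-1.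
  by rewrite /mesh sqrtrM ?ltW// mulrAC divff ?mul1r// gt_eqF.
rewrite -(normal_prob_scale sT0 sm0 mA).
exact: (grid_increment_law n i (mscale_pre mA)).
Qed.

(** The value at time 1 of the rescaled path [s |-> W (s * T) / sqrt T].  Only
    increments enter, [W 0] being zero merely almost surely. *)
Definition end_value w : R := increment W 0 T w / Num.sqrt T.

(** The integral from 0 to 1 of the square of the same rescaled path, after a
    linear change of variable. *)
Definition square_mean w : R :=
  time_integral (fun t => increment W 0 t w ^+ 2) T / T ^+ 2.

(** The state is the current value of the rescaled path and the Riemann sum of
    its square. *)
Definition squares_step n (zx : (R * R) * R) : R * R :=
  (zx.1.1 + zx.2, zx.1.2 + zx.1.1 ^+ 2 / n.+1%:R).

Lemma measurable_squares_step n : measurable_fun setT (squares_step n).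
Proof.
have m11 : measurable_fun setT (fun zx : (R * R) * R => zx.1.1).
  by apply: measurableT_comp => //; exact: measurable_fst.
have m12 : measurable_fun setT (fun zx : (R * R) * R => zx.1.2).
  by apply: measurableT_comp => //; exact: measurable_fst.
apply: measurable_fun_pair; apply: measurable_funD => //.
by apply: measurable_funM => //; exact: measurable_funX.
Qed.

Lemma squares_chainE n k w :
  driven_chain (squares_step n) (0, 0) (scaled_increment n) k w =
  (increment W 0 (k%:R * mesh T n) w / Num.sqrt T,
   T^-1 / n.+1%:R * \sum_(i < k) increment W 0 (i%:R * mesh T n) w ^+ 2).
Proof.
elim: k => [|k ih] /=; first by rewrite big_ord0 mulr0 mul0r /increment subrr mul0r.
rewrite ih /squares_step/=; congr (_, _).
  by rewrite -mulrDl -!sum_grid_increment big_ord_recr.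
rewrite big_ord_recr/= mulrDr; congr (_ + _).
rewrite exprMn exprVn sqr_sqrtr ?ltW//; ring.
Qed.

Definition centered_path w (t : R) := increment W 0 (Num.max 0 t) w.

Lemma continuous_centered_path w : continuous (centered_path w).
Proof.
have cW := continuous_extended_path (sbm_continuous bmW) (w := w).
by move=> t; exact: (cvgB (cW t) (cvg_cst (W 0 w))).
Qed.

Lemma time_integral_centered_path w :
  time_integral (fun t => centered_path w t ^+ 2) T =
  time_integral (fun t => increment W 0 t w ^+ 2) T.
Proof.
apply: eq_Rintegral => t; rewrite inE/= in_itv/= => /andP[t0 _].
by rewrite /centered_path max_r.
Qed.

Lemma squares_chain_cvg w :
  driven_chain (squares_step n) (0, 0) (scaled_increment n) n.+1 w @[n --> \oo] -->
  (end_value w, square_mean w).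
Proof.
pose y := centered_path w.
have cy2 := continuous_square (@continuous_centered_path w).
have := riemann_sum_cvg cy2 T0.
rewrite time_integral_centered_path.
move=> h.
under eq_fun do rewrite squares_chainE meshM.
have sumE n : T^-1 / n.+1%:R * \sum_(i < n.+1) increment W 0 (i%:R * mesh T n) w ^+ 2 =
    (T ^+ 2)^-1 * (mesh T n * \sum_(i < n.+1) y (i%:R * mesh T n) ^+ 2).
  rewrite mulrA; congr (_ * _).
    have nz : n.+1%:R != 0 :> R by rewrite pnatr_eq0.
    by rewrite /mesh; move: (n.+1%:R) nz => N nz; field; rewrite nz gt_eqF.
  apply: eq_bigr => i _; rewrite /y /centered_path max_r//.
  by rewrite mulr_ge0// mesh_ge0.
under eq_fun do rewrite sumE.
have h1 : (fun _ : nat => end_value w) @ \oo --> end_value w by exact: cvg_cst.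
have h2 : (fun n => (T ^+ 2)^-1 * (mesh T n * \sum_(i < n.+1) y (i%:R * mesh T n) ^+ 2))
    @ \oo --> square_mean w.
  by rewrite /square_mean mulrC; apply: cvgMr.
exact: (cvg_pair h1 h2).
Qed.

(** A Gaussian law has no atom. *)
Lemma end_value_neq0 : {ae P, forall w, end_value w != 0}.
Proof.
exists (increment W 0 T @^-1` [set 0]); split.
- by rewrite -[X in measurable X]setTI; apply: measurable_increment.
- rewrite (sbm_gaussian bmW (lexx 0) T0 (measurable_set1 0)) subr0.
  have /null_content_dominatesP := normal_prob_dominates (0 : R) (Num.sqrt T).
  move=> h; exact: (h _ (measurable_set1 0) (lebesgue_measure_set1 0)).
- move=> w /= /negP; rewrite negbK mulf_eq0 invr_eq0.
  by rewrite (gt_eqF (_ : 0 < Num.sqrt T)) ?orbF ?sqrtr_gt0// => /eqP.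
Qed.

(** A continuous path with vanishing square integral vanishes at its endpoint. *)
Lemma square_mean_gt0 w : end_value w != 0 -> 0 < square_mean w.
Proof.
move=> U0; rewrite divr_gt0 ?exprn_gt0//.
pose y := centered_path w.
have cy2 := continuous_square (@continuous_centered_path w).
rewrite -time_integral_centered_path.
apply: time_integral_gt0 => //; first by move=> t; exact: sqr_ge0.
rewrite /y /centered_path max_r ?ltW// exprn_even_gt0//=.
by apply: contra U0 => /eqP h; rewrite /end_value h mul0r.
Qed.

Lemma measurable_end_value : measurable_fun [set: Omega] end_value.
Proof. by apply: measurable_funM => //; exact: measurable_increment. Qed.

Lemma measurable_squares_chain n k : measurable_fun [set: Omega]
  (driven_chain (squares_step n) (0, 0) (scaled_increment n) k).
Proof.
apply: measurable_driven_chain; first exact: measurable_squares_step.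
exact: measurable_scaled_increment.
Qed.

Lemma measurable_square_mean : measurable_fun [set: Omega] square_mean.
Proof.
apply: (@measurable_fun_cvg _ _ _ _
  (fun n w => (driven_chain (squares_step n) (0, 0) (scaled_increment n) n.+1 w).2)).
  move=> n; apply: measurableT_comp; first exact: measurable_snd.
  exact: measurable_squares_chain.
move=> w _; have := @squares_chain_cvg w.
move=> h; exact: (cvg_comp _ _ h (@cvg_snd _ _ _ _ _)).
Qed.

(** Continuity of [F] is required only where [v > 0], because the limit lies
    there almost surely: this admits functionals that divide by [square_mean]. *)
Lemma integral_squares_chain_cvg (F : R * R -> R) (K : R) :
  measurable_fun setT F -> (forall z, `|F z| <= K) ->
  (forall u v, 0 < v -> {for (u, v), continuous F}) ->
  (\int[P]_w (F (driven_chain (squares_step n) (0, 0) (scaled_increment n)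
    n.+1 w))%:E)%E @[n --> \oo] -->
  (\int[P]_w (F (end_value w, square_mean w))%:E)%E.
Proof.
move=> mF FK cF.
have := @dominated_convergence _ _ _ P setT measurableT
  (fun n w => (F (driven_chain (squares_step n) (0, 0)
    (scaled_increment n) n.+1 w))%:E)
  (fun w => (F (end_value w, square_mean w))%:E) (EFin \o cst K).
case => //.
- move=> n; apply/measurable_EFinP; apply: measurableT_comp => //.
  exact: measurable_squares_chain.
- apply/measurable_EFinP; apply: measurableT_comp => //.
  apply: measurable_fun_pair; first exact: measurable_end_value.
  exact: measurable_square_mean.
- apply: filterS end_value_neq0 => w /square_mean_gt0 V0 _.
  apply: cvg_EFin; first exact: nearW.
  exact: cvg_comp (@squares_chain_cvg w) (cF _ _ V0).
- exact: finite_measure_integrable_cst.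
- by apply: aeW => w n _; rewrite /= lee_fin.
Qed.

End brownian_grid.

Lemma brownian_functional_law {d d' : measure_display} {Omega : measurableType d}
    {Omega' : measurableType d'} {R : realType}
    (P : probability Omega R) (P' : probability Omega' R) (W : process P) (B : process P')
    (T T' : R) (F : R * R -> R) (K : R) :
  standard_brownian_motion W -> standard_brownian_motion B -> 0 < T -> 0 < T' ->
  measurable_fun setT F -> (forall z, `|F z| <= K) ->
  (forall u v, 0 < v -> {for (u, v), continuous F}) ->
  (\int[P]_w (F (end_value W T w, square_mean W T w))%:E =
   \int[P']_w (F (end_value B T' w, square_mean B T' w))%:E)%E.
Proof.
move=> bW bB T0 T0' mF FK cF.
have hW := integral_squares_chain_cvg bW T0 mF FK cF.
have hB := integral_squares_chain_cvg bB T0' mF FK cF.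
apply: (cvg_unique _ hW) => //.
rewrite (_ : (fun n => _) = (fun n => \int[P']_w (F (driven_chain (@squares_step R n) (0, 0)
  (scaled_increment B T' n) n.+1 w))%:E)%E)//.
apply/funext => n; apply: (@driven_chain_integral_eq _ _ _ _ _ _ _ _ _ _ _ _ _ _ _ K) => //.
- exact: measurable_squares_step.
- exact: measurable_scaled_increment.
- exact: measurable_scaled_increment.
- exact: scaled_increment_indep.
- exact: scaled_increment_indep.
- move=> i A mA; transitivity (normal_prob 0 (Num.sqrt n.+1%:R^-1) A).
    exact: scaled_increment_law.
  by apply: esym; exact: scaled_increment_law.
Qed.

(** * The Euler scheme of the Ornstein-Uhlenbeck equation *)

Section fatou_chebyshev.
Context {d : measure_display} {Omega : measurableType d} {R : realType}.
Variable P : probability Omega R.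

Let einfs_le (u : (\bar R)^nat) n : (einfs u n <= u n)%E.
Proof. by apply: ereal_inf_lbound; exists n => //=. Qed.

Let limn_einf_le (u : (\bar R)^nat) (C : \bar R) :
  (\forall n \near \oo, u n <= C)%E -> (limn_einf u <= C)%E.
Proof.
move=> uC; rewrite limn_einf_lim; apply: lime_le; first exact: is_cvg_einfs.
by apply: filterS uC => n; apply: le_trans; exact: einfs_le.
Qed.

Let limn_einf_ge0 (u : (\bar R)^nat) : (forall n, 0 <= u n)%E -> (0 <= limn_einf u)%E.
Proof.
move=> u0; rewrite limn_einf_lim; apply: lime_ge; first exact: is_cvg_einfs.
by apply: nearW => n; apply: le_ereal_inf_tmp => _ [k _ <-].
Qed.

(** The lower limit of the [(Y_ n) ^+ 2] is measurable and, almost everywhere,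
    equal to [Y ^+ 2]; Fatou's lemma bounds its mean.  The null set where the
    convergence fails is put into [E]. *)
Lemma fatou_chebyshev (Y_ : nat -> Omega -> R) (Y : Omega -> R) (C c : R) :
  0 < c -> (forall n, measurable_fun [set: Omega] (Y_ n)) ->
  {ae P, forall w, Y_ n w @[n --> \oo] --> Y w} ->
  (\forall n \near \oo, (\int[P]_w ((Y_ n w) ^+ 2)%:E <= C%:E)%E) ->
  exists E, [/\ measurable E, (P E <= (C / c ^+ 2)%:E)%E &
    forall w, ~ E w -> `|Y w| <= c].
Proof.
move=> c0 mY cY hC.
have c20 : 0 < c ^+ 2 by rewrite exprn_gt0.
pose g_ n w := ((Y_ n w) ^+ 2)%:E.
have mg n : measurable_fun [set: Omega] (g_ n).
  by apply/measurable_EFinP; exact: measurable_funX.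
pose g w := limn_einf (g_ ^~ w).
have mg' : measurable_fun [set: Omega] g.
  apply: measurableT_comp => //.
  by apply: measurable_fun_limn_esup => n; exact: measurableT_comp.
have g_ge0 w : (0 <= g w)%E by apply: limn_einf_ge0 => n; rewrite lee_fin sqr_ge0.
have intg : (\int[P]_w g w <= C%:E)%E.
  apply: (@le_trans _ _ (limn_einf (fun n => \int[P]_w g_ n w)%E)).
    by apply: fatou => // n w _; rewrite lee_fin sqr_ge0.
  exact: limn_einf_le.
have [N [mN N0 hN]] := cY.
pose A := [set w | ((c ^+ 2)%:E <= `|g w|)%E].
have mA : measurable A.
  rewrite -[X in measurable X]setTI.
  by apply: emeasurable_fun_c_infty => //; exact: measurableT_comp.
exists (A `|` N); split.
- exact: measurableU.
- apply: (@le_trans _ _ (P A + P N)%E); first exact: measureU2.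
  have -> : P N = 0%E by exact: N0.
  rewrite adde0.
  have := @le_integral_abse _ _ _ P setT measurableT g (c ^+ 2) mg' c20.
  rewrite setTI => h.
  rewrite EFinM lee_pdivlMr// muleC.
  apply: (le_trans h); apply: le_trans intg.
  rewrite le_eqVlt; apply/orP; left; apply/eqP; apply: eq_integral => w _.
  by rewrite gee0_abs.
- move=> w /not_orP[Aw Nw].
  have Yw : Y_ n w @[n --> \oo] --> Y w by apply: contrapT => h; apply: Nw; apply: hN.
  have gE : g w = ((Y w) ^+ 2)%:E.
    apply: (cvg_limn_einf_sup _).1; apply: cvg_EFin; first exact: nearW.
    exact: (cvg_comp _ _ Yw (@exprn_continuous _ 2 (Y w))).
  move/negP: Aw; rewrite -ltNge gE gee0_abs ?lee_fin ?sqr_ge0// lte_fin => h.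
  have c0' := ltW c0.
  rewrite -(@ler_pXn2r _ 2) ?nnegrE//.
  by rewrite -normrX ger0_norm ?sqr_ge0// ltW.
Qed.

End fatou_chebyshev.

Section euler_scheme.
Context {R : realType}.
Variables (theta T : R) (x b : R -> R).
Hypotheses (theta0 : theta < 0) (T0 : 0 < T) (cx : continuous x).
Hypothesis b0 : b 0 = 0.
Hypothesis x_sde : forall t, 0 <= t -> x t = theta * time_integral x t + b t.

Fixpoint euler (h : R) (k : nat) : R :=
  if k is j.+1 then (1 + theta * h) * euler h j + (b (j.+1%:R * h) - b (j%:R * h))
  else 0.

(** As [theta < 0], a step of the scheme does not expand once [h <= 1 / |theta|].
    The local errors therefore add up, and no Gronwall inequality is needed. *)
Lemma euler_uniformly_close (e : R) : 0 < e ->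
  \forall n \near \oo, forall k, (k <= n.+1)%N ->
  `|euler (mesh T n) k - x (k%:R * mesh T n)| <= e.
Proof.
move=> e0.
have e10 : 0 < e / (- theta * T) by rewrite divr_gt0// mulr_gt0// oppr_gt0.
have h1 : \forall n \near \oo, mesh T n < (- theta)^-1.
  have := mesh_cvg0 T => /cvgr0Pnorm_lt /(_ (- theta)^-1).
  rewrite invr_gt0 oppr_gt0 => /(_ theta0); apply: filterS => n.
  by rewrite ger0_norm ?mesh_ge0.
have h2 := time_integral_mesh cx T0 e10.
near=> n.
have hn1 : mesh T n < (- theta)^-1 by near: n.
have hn2 : forall i, (i < n.+1)%N ->
  `|mesh T n * x (i%:R * mesh T n) - (time_integral x (i.+1%:R * mesh T n)
    - time_integral x (i%:R * mesh T n))| <= e / (- theta * T) * mesh T n by near: n.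
set h := mesh T n in hn1 hn2 *.
have h0 : 0 < h by exact: mesh_gt0.
have a01 : `|1 + theta * h| <= 1.
  have : - theta * h < 1 by rewrite mulrC -ltr_pdivlMr ?oppr_gt0// mul1r.
  have : 0 < - theta * h by rewrite mulr_gt0 ?oppr_gt0.
  by rewrite ler_norml; lra.
suff H k : (k <= n.+1)%N -> `|euler h k - x (k%:R * h)| <= e / T * (k%:R * h).
  move=> k kn; apply: (le_trans (H k kn)).
  have eT0 : 0 <= e / T by rewrite divr_ge0 ?ltW.
  rewrite -[leRHS](@divfK _ T) ?gt_eqF// ler_wpM2l//.
  exact: meshM_le.
elim: k => [_|k ih kn].
  by rewrite /= mul0r x_sde// time_integral0 b0 !mulr0 addr0 subr0 normr0.
have xk : x (k.+1%:R * h) = x (k%:R * h) +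
    theta * (time_integral x (k.+1%:R * h) - time_integral x (k%:R * h)) +
    (b (k.+1%:R * h) - b (k%:R * h)).
  have hk j : 0 <= j%:R * h by rewrite mulr_ge0// ltW.
  by rewrite (x_sde (hk k)) (x_sde (hk k.+1)); ring.
rewrite /= xk.
set I := time_integral x _ - _ in xk *.
rewrite [X in `|X|](_ : _ = (1 + theta * h) * (euler h k - x (k%:R * h)) +
  theta * (h * x (k%:R * h) - I)); last by ring.
apply: (le_trans (ler_normD _ _)).
have -> : e / T * (k.+1%:R * h) =
    e / T * (k%:R * h) + - theta * (e / (- theta * T) * h).
  have tn : theta != 0 by rewrite lt_eqF.
  have Tn : T != 0 by rewrite gt_eqF.
  by rewrite -natr1; field; rewrite ?oppr_eq0 tn Tn.
apply: lerD; rewrite normrM.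
  rewrite -[leRHS]mul1r ler_pM// ih// ltnW//.
rewrite ltr0_norm// ler_wpM2l ?hn2// oppr_ge0 ltW//.
Unshelve. all: by end_near. Qed.

Lemma euler_cvg : euler (mesh T n) n.+1 @[n --> \oo] --> x T.
Proof.
apply/cvgrPdist_le => e e0; apply: filterS (euler_uniformly_close e0) => n /(_ _ (leqnn _)).
by rewrite meshM distrC.
Qed.

(** The scheme is compared with the Riemann sums of [x ^+ 2]. *)
Lemma euler_energy_cvg :
  mesh T n * \sum_(i < n.+1) euler (mesh T n) i ^+ 2 @[n --> \oo] -->
  time_integral (fun t => x t ^+ 2) T.
Proof.
have cx2 := continuous_square cx.
have hR := riemann_sum_cvg cx2 T0.
set J := time_integral _ T in hR *.
have J0 : 0 <= J by apply: time_integral_ge0 => t; exact: sqr_ge0.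
clearbody J.
set Rn := (fun n => mesh T n * \sum_(i < n.+1) x (i%:R * mesh T n) ^+ 2) in hR.
set Sn := (fun n => mesh T n * \sum_(i < n.+1) euler (mesh T n) i ^+ 2).
suff hdiff : Sn n - Rn n @[n --> \oo] --> 0.
  rewrite -[J]add0r (_ : Sn = (fun n => (Sn n - Rn n) + Rn n)); first exact: cvgD.
  by apply/funext => n; rewrite subrK.
apply/cvgr0Pnorm_le => e e0.
have D0 : 0 < 2 * T + J + 1.
  apply: ltr_wpDl; last exact: ltr01.
  by apply: addr_ge0 => //; apply: mulr_ge0 => //; exact: ltW.
pose dl := Num.min 1 (e / (2 * T + J + 1)).
have dl0 : 0 < dl by rewrite lt_min ltr01 divr_gt0.
have dl1 : dl <= 1 by rewrite ge_min lexx.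
have dl2 : dl * (2 * T + J + 1) <= e by rewrite -ler_pdivlMr// ge_min lexx orbT.
have RJ : \forall n \near \oo, Rn n <= J + 1.
  have /cvgrPdist_le /(_ 1 ltr01) := hR; apply: filterS => n.
  by rewrite ler_norml => /andP[h _]; rewrite lerBDr in h; lra.
have hn := euler_uniformly_close dl0.
near=> n.
have RJn : Rn n <= J + 1 by near: n.
have en : forall k, (k <= n.+1)%N ->
  `|euler (mesh T n) k - x (k%:R * mesh T n)| <= dl by near: n.
have h0 := mesh_ge0 n T0.
rewrite /Sn /Rn -mulrBr -sumrB normrM ger0_norm//.
apply: le_trans dl2.
(* If [|u - v| <= dl <= 1] then [|u^2 - v^2| <= 2 dl + dl v^2]: the Riemann
   sums themselves replace a bound on the path. *)
apply: (@le_trans _ _ (mesh T n *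
    \sum_(i < n.+1) (2 * dl + dl * x (i%:R * mesh T n) ^+ 2))).
  rewrite ler_wpM2l// (le_trans (ler_norm_sum _ _ _))//; apply: ler_sum => i _.
  have := en i (ltnW (ltn_ord i)).
  move: (euler _ _) (x _) => u v uv.
  have uv2 : (u - v) ^+ 2 <= dl.
    rewrite -real_normK ?num_real// (le_trans (_ : _ <= dl ^+ 2))//.
      by rewrite lerXn2r ?nnegrE ?normr_ge0// ltW.
    by rewrite expr2 ler_piMr// ltW.
  have uv3 : `|(u - v) * v| <= dl * ((1 + v ^+ 2) / 2).
    rewrite normrM ler_pM//.
    have := sqr_ge0 (`|v| - 1); rewrite sqrrB1 real_normK ?num_real//; lra.
  have -> : u ^+ 2 - v ^+ 2 = (u - v) ^+ 2 + 2 * ((u - v) * v) by ring.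
  rewrite (le_trans (ler_normD _ _))// (ger0_norm (sqr_ge0 _)) normrM (ger0_norm (ler0n _ 2)).
  lra.
rewrite big_split/= sumr_const card_ord mulrDr -mulr_sumr mulrCA.
have -> : mesh T n * (2 * dl *+ n.+1) = dl * (2 * T).
  by rewrite -{2}(meshM T n) -mulr_natl; ring.
have dl0' := ltW dl0.
by rewrite -mulrDr ler_wpM2l// -addrA lerD2l.
Unshelve. all: by end_near. Qed.

End euler_scheme.

(** * Second moments along the scheme *)

Section ou_moments.
Context {d : measure_display} {Omega : measurableType d} {R : realType}.
Variables (P : probability Omega R) (W : process P).
Hypothesis bmW : standard_brownian_motion W.
Variables theta T : R.
Hypotheses (theta0 : theta < 0) (T0 : 0 < T).

(** The first component is the Euler scheme; the second accumulates the discrete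
    martingale whose limit is [\int_0^T X dW].  The term [(e^2 - h) / 2] is
    chosen so that the discrete Ito formula [ou_chain_martingaleE] is exact. *)
Definition ou_step (n : nat) (ze : (R * R) * R) : R * R :=
  let a := 1 + theta * mesh T n in
  (a * ze.1.1 + ze.2,
   ze.1.2 + a * ze.1.1 * ze.2 + (ze.2 ^+ 2 - mesh T n) / 2).

Lemma measurable_ou_step n : measurable_fun setT (ou_step n).
Proof.
have m11 : measurable_fun setT (fun zx : (R * R) * R => zx.1.1).
  by apply: measurableT_comp => //; exact: measurable_fst.
have m12 : measurable_fun setT (fun zx : (R * R) * R => zx.1.2).
  by apply: measurableT_comp => //; exact: measurable_fst.
apply: measurable_fun_pair; first by apply: measurable_funD => //; exact: measurable_funM.
apply: measurable_funD; last first.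
  by apply: measurable_funM => //; apply: measurable_funB => //; exact: measurable_funX.
by apply: measurable_funD => //; apply: measurable_funM => //; exact: measurable_funM.
Qed.

Definition ou_chain n k : Omega -> R * R :=
  driven_chain (ou_step n) (0, 0) (grid_increment W T n) k.

Lemma measurable_ou_chain n k : measurable_fun [set: Omega] (ou_chain n k).
Proof.
apply: measurable_driven_chain; first exact: measurable_ou_step.
exact: measurable_grid_increment.
Qed.

Lemma ou_chain_eulerE n k w :
  (ou_chain n k w).1 = euler theta (fun t => increment W 0 t w) (mesh T n) k.
Proof.
elim: k => //= k ih; rewrite -[driven_chain _ _ _ _ _]/(ou_chain n k w) ih.
by rewrite /grid_increment /increment; congr (_ + _); ring.
Qed.

Lemma ou_chain_martingaleE n k w :
  (ou_chain n k w).2 = ((ou_chain n k w).1 ^+ 2 - k%:R * mesh T n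
    - (2 * theta + theta ^+ 2 * mesh T n) *
      (mesh T n * \sum_(i < k) (ou_chain n i w).1 ^+ 2)) / 2.
Proof.
elim: k => [|k ih]; first by rewrite big_ord0 /=; ring.
rewrite big_ord_recr/= -[driven_chain _ _ _ _ _]/(ou_chain n k w) ih -natr1.
by field.
Qed.

(** Integrating out the last increment, of variance [mesh T n], leaves a function
    of the state alone. *)
Lemma ou_integral_step n k (G : (R * R) * R -> R) (c0 c1 c2 c3 c4 : R * R -> R) :
  measurable_fun setT G -> (forall z, 0 <= G z) ->
  (forall z y, G (z, y) =
    c0 z + c1 z * y + c2 z * y ^+ 2 + c3 z * y ^+ 3 + c4 z * y ^+ 4) ->
  (\int[P]_w (G (ou_chain n k w, grid_increment W T n k w))%:E =
  \int[P]_w (c0 (ou_chain n k w) + c2 (ou_chain n k w) * mesh T n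
     + 3 * c4 (ou_chain n k w) * mesh T n ^+ 2)%:E)%E.
Proof.
move=> mG G0 GE.
have h0 : 0 < mesh T n by exact: mesh_gt0.
rewrite (@ge0_integral_driven_chain _ _ _ _ _ P (ou_step n) (0, 0)
  (grid_increment W T n) _ _ _ k
  (normal_prob 0 (Num.sqrt (mesh T n))) (EFin \o G)) => //.
- apply: eq_integral => w _ /=.
  under eq_integral do rewrite GE.
  rewrite integral_normal_prob_quartic ?sqrtr_gt0//.
  have -> : Num.sqrt (mesh T n) ^+ 4 = mesh T n ^+ 2.
    by rewrite -[4%N]/(2 * 2)%N exprM sqr_sqrtr// ltW.
  by rewrite sqr_sqrtr// ltW.
- exact: measurable_ou_step.
- exact: measurable_grid_increment.
- exact: grid_increment_indep.
- by move=> A mA; exact: grid_increment_law.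
- exact/measurable_EFinP.
Qed.

Let a n := 1 + theta * mesh T n.

Let a2 n : mesh T n < (- theta)^-1 -> a n ^+ 2 <= 1 + theta * mesh T n.
Proof.
move=> hn; have h0 := mesh_gt0 n T0.
have h1 : - theta * mesh T n < 1 by rewrite mulrC -ltr_pdivlMr ?oppr_gt0// mul1r.
have h2 : 0 < - theta * mesh T n by rewrite mulr_gt0 ?oppr_gt0.
rewrite /a; nra.
Qed.

Let a2_le1 n : mesh T n < (- theta)^-1 -> a n ^+ 2 <= 1.
Proof.
move=> hn; apply: (le_trans (a2 hn)); rewrite gerDl nmulr_rle0//.
exact: mesh_ge0.
Qed.

Let ge0_integral_affine (f g : Omega -> R) (al be : R) :
  measurable_fun [set: Omega] f -> measurable_fun [set: Omega] g ->
  (forall w, 0 <= f w) -> (forall w, 0 <= g w) -> 0 <= al -> 0 <= be ->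
  (\int[P]_w (g w + al * f w + be)%:E =
   \int[P]_w (g w)%:E + al%:E * \int[P]_w (f w)%:E + be%:E)%E.
Proof.
move=> mf mg f0 g0 al0 be0.
have maf : measurable_fun [set: Omega] (fun w => (al * f w)%:E).
  by apply/measurable_EFinP; exact: measurable_funM.
under eq_integral do rewrite 2!EFinD.
have mEg : measurable_fun [set: Omega] (fun w => (g w)%:E) by exact/measurable_EFinP.
have g0' w : [set: Omega] w -> (0 <= (g w)%:E)%E by rewrite lee_fin.
have af0 w : [set: Omega] w -> (0 <= (al * f w)%:E)%E by rewrite lee_fin mulr_ge0.
have gaf0 w : [set: Omega] w -> (0 <= (g w)%:E + (al * f w)%:E)%E.
  by move=> _; rewrite adde_ge0 ?g0' ?af0.
have mgaf : measurable_fun [set: Omega] (fun w => (g w)%:E + (al * f w)%:E)%E.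
  exact: emeasurable_funD.
rewrite ge0_integralD// ge0_integralD//.
rewrite integral_cst//.
have PT : P [set: Omega] = 1%E := probability_setT P.
rewrite [X in (be%:E * X)%E]PT mule1.
congr (_ + _ + _)%E.
under eq_integral do rewrite EFinM.
rewrite ge0_integralZl//; first exact/measurable_EFinP.
by move=> w _; rewrite lee_fin.
Qed.

Let measurable_chain1 n k : measurable_fun [set: Omega] (fun w => (ou_chain n k w).1).
Proof. by apply: measurableT_comp; [exact: measurable_fst|exact: measurable_ou_chain]. Qed.

Let measurable_chain2 n k : measurable_fun [set: Omega] (fun w => (ou_chain n k w).2).
Proof. by apply: measurableT_comp; [exact: measurable_snd|exact: measurable_ou_chain]. Qed.

(** One step maps the second moment [m] to [a^2 m + h] with
    [a^2 <= 1 - |theta| h], and [1 / |theta|] is a fixed point of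
    [m |-> (1 - |theta| h) m + h]. *)
Lemma ou_second_moment n k : mesh T n < (- theta)^-1 ->
  (\int[P]_w ((ou_chain n k w).1 ^+ 2)%:E <= ((- theta)^-1)%:E)%E.
Proof.
move=> hn; have h0 := mesh_gt0 n T0.
have ti0 : 0 < (- theta)^-1 by rewrite invr_gt0 oppr_gt0.
elim: k => [|k ih].
  rewrite /ou_chain/=; under eq_integral do rewrite expr0n/=.
  by rewrite integral0 lee_fin ltW.
pose G (ze : (R * R) * R) := (a n * ze.1.1 + ze.2) ^+ 2.
have mG : measurable_fun setT G.
  apply: measurable_funX; apply: measurable_funD => //; apply: measurable_funM => //.
  by apply: measurableT_comp => //; exact: measurable_fst.
rewrite [leLHS](_ : _ = \int[P]_w (G (ou_chain n k w, grid_increment W T n k w))%:E)%E//.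
rewrite (@ou_integral_step n k G (fun z => (a n * z.1) ^+ 2) (fun z => 2 * (a n * z.1))
  (fun=> 1) (fun=> 0) (fun=> 0))//; last 2 first.
- by move=> z; exact: sqr_ge0.
- by move=> z y; rewrite /G/=; ring.
rewrite (eq_integral (fun w =>
    (0 + a n ^+ 2 * (ou_chain n k w).1 ^+ 2 + mesh T n)%:E)); last first.
  by move=> w _; congr EFin; ring.
rewrite ge0_integral_affine//; last 4 first.
- by apply: measurable_funX.
- by move=> w; exact: sqr_ge0.
- exact: sqr_ge0.
- exact: ltW.
rewrite integral0 add0e.
apply: (@le_trans _ _ ((a n ^+ 2)%:E * ((- theta)^-1)%:E + (mesh T n)%:E)%E).
  by rewrite leeD2r// lee_wpmul2l// lee_fin sqr_ge0.
rewrite -EFinM -EFinD lee_fin.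
apply: (@le_trans _ _ ((1 + theta * mesh T n) * (- theta)^-1 + mesh T n)).
  by rewrite lerD2r ler_wpM2r ?a2// ltW.
rewrite le_eqVlt; apply/orP; left; apply/eqP.
by field; rewrite lt_eqF.
Qed.

(** Successive increments of the martingale are orthogonal, each of variance
    [a^2 h E x^2 + h^2 / 2 <= h / |theta| + h^2 / 2]. *)
Lemma ou_martingale_moment n k : mesh T n < (- theta)^-1 ->
  (\int[P]_w ((ou_chain n k w).2 ^+ 2)%:E <=
   (k%:R * (mesh T n / - theta + mesh T n ^+ 2 / 2))%:E)%E.
Proof.
move=> hn; have h0 := mesh_gt0 n T0.
have ti0 : 0 < (- theta)^-1 by rewrite invr_gt0 oppr_gt0.
elim: k => [|k ih].
  rewrite /ou_chain/=; under eq_integral do rewrite expr0n/=.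
  by rewrite integral0 mul0r.
pose h := mesh T n.
pose G (ze : (R * R) * R) := (ze.1.2 + a n * ze.1.1 * ze.2 + (ze.2 ^+ 2 - h) / 2) ^+ 2.
have mG : measurable_fun setT G.
  apply: measurable_funX.
  have := @measurable_ou_step n.
  exact: measurableT_comp (@measurable_snd _ _ _ _).
rewrite [leLHS](_ : _ = \int[P]_w (G (ou_chain n k w, grid_increment W T n k w))%:E)%E//.
rewrite (@ou_integral_step n k G (fun z => (z.2 - h / 2) ^+ 2)
  (fun z => 2 * (z.2 - h / 2) * (a n * z.1))
  (fun z => (a n * z.1) ^+ 2 + (z.2 - h / 2)) (fun z => a n * z.1) (fun=> 4^-1))//; last 2 first.
- by move=> z; exact: sqr_ge0.
- by move=> z y; rewrite /G/=; field.
rewrite (eq_integral (fun w => ((ou_chain n k w).2 ^+ 2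
    + (a n ^+ 2 * h) * (ou_chain n k w).1 ^+ 2 + h ^+ 2 / 2)%:E)); last first.
  by move=> w _; congr EFin; rewrite -/h; field.
rewrite ge0_integral_affine//; last 6 first.
- by apply: measurable_funX.
- by apply: measurable_funX.
- by move=> w; exact: sqr_ge0.
- by move=> w; exact: sqr_ge0.
- by rewrite mulr_ge0 ?sqr_ge0// ltW.
- by rewrite divr_ge0 ?sqr_ge0.
rewrite -[k.+1%:R]natr1 mulrDl mul1r addrA -/h 2!EFinD leeD2r// leeD//.
apply: (@le_trans _ _ ((a n ^+ 2 * h)%:E * ((- theta)^-1)%:E)%E).
  rewrite lee_wpmul2l//; first by rewrite lee_fin mulr_ge0 ?sqr_ge0// ltW.
  exact: ou_second_moment.
rewrite -EFinM lee_fin ler_wpM2r ?(ltW ti0)// ler_piMl ?(ltW h0)//.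
exact: a2_le1.
Qed.

End ou_moments.

Section ou_tails.
Context {d : measure_display} {Omega : measurableType d} {R : realType}.
Variables (P : probability Omega R) (W X : process P).
Hypothesis bmW : standard_brownian_motion W.
Hypothesis cX : continuous_paths X.
Variables theta T : R.
Hypotheses (theta0 : theta < 0) (T0 : 0 < T).
Hypothesis X_ou : {ae P, forall w, forall t, 0 <= t ->
  X t w = theta * time_integral (sample_path X w) t + increment W 0 t w}.

Let xe w (t : R) := X (Num.max 0 t) w.

Let xeE w t : 0 <= t -> xe w t = X t w.
Proof. by move=> t0; rewrite /xe max_r. Qed.

Let cxe w : continuous (xe w).
Proof. exact: continuous_extended_path. Qed.

Let b w t := increment W 0 t w.

Let b0 w : b w 0 = 0. Proof. by rewrite /b /increment subrr. Qed.

Let small_mesh : \forall n \near \oo, mesh T n < (- theta)^-1.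
Proof.
have := mesh_cvg0 T => /cvgr0Pnorm_lt /(_ (- theta)^-1).
rewrite invr_gt0 oppr_gt0 => /(_ theta0); apply: filterS => n.
by rewrite ger0_norm ?mesh_ge0.
Qed.

Let xe_ou : {ae P, forall w, forall t, 0 <= t ->
  xe w t = theta * time_integral (xe w) t + b w t}.
Proof.
apply: filterS X_ou => w h t t0; rewrite xeE// h//.
congr (_ * _ + _); apply: time_integral_extend => s s0.
by rewrite xeE.
Qed.

Lemma ou_endpoint_tail c : 0 < c -> exists E, [/\ measurable E,
  (P E <= ((- theta)^-1 / c ^+ 2)%:E)%E & forall w, ~ E w -> `|X T w| <= c].
Proof.
move=> c0.
apply: (@fatou_chebyshev _ _ _ P (fun n w => (ou_chain W theta T n n.+1 w).1)) => //.
- move=> n; apply: measurableT_comp; first exact: measurable_fst.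
  exact: measurable_ou_chain.
- apply: filterS xe_ou => w h.
  under eq_fun do rewrite ou_chain_eulerE.
  rewrite -(xeE w (ltW T0)).
  exact: (euler_cvg theta0 T0 (@cxe w) (b0 w) h).
- apply: filterS small_mesh => n hn; exact: (ou_second_moment bmW theta0 T0 n.+1 hn).
Qed.

Lemma ou_martingale_tail c : 0 < c -> exists E, [/\ measurable E,
  (P E <= (2 * T / - theta / c ^+ 2)%:E)%E & forall w, ~ E w ->
   `|(X T w ^+ 2 - T - 2 * theta * time_integral (fun t => X t w ^+ 2) T) / 2| <= c].
Proof.
move=> c0.
apply: (@fatou_chebyshev _ _ _ P (fun n w => (ou_chain W theta T n n.+1 w).2)) => //.
- move=> n; apply: measurableT_comp; first exact: measurable_snd.
  exact: measurable_ou_chain.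
- apply: filterS xe_ou => w h.
  under eq_fun do rewrite ou_chain_martingaleE meshM.
  have e1 := euler_cvg theta0 T0 (@cxe w) (b0 w) h.
  have e2 := euler_energy_cvg theta0 T0 (@cxe w) (b0 w) h.
  have -> : time_integral (fun t => X t w ^+ 2) T = time_integral (fun t => xe w t ^+ 2) T.
    by apply: time_integral_extend => s s0; rewrite xeE.
  rewrite -(xeE w (ltW T0)).
  apply: cvgMl; apply: cvgB.
    apply: cvgB; last exact: cvg_cst.
    under eq_fun do rewrite ou_chain_eulerE.
    exact: (cvg_comp _ _ e1 (@exprn_continuous _ 2 _)).
  have -> : 2 * theta * time_integral (fun t => xe w t ^+ 2) T =
    (2 * theta + theta ^+ 2 * 0) * time_integral (fun t => xe w t ^+ 2) T by ring.
  apply: cvgM; last first.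
    under eq_fun do under eq_bigr do rewrite ou_chain_eulerE.
    exact: e2.
  apply: cvgD; first exact: cvg_cst.
  apply: cvgMr; exact: mesh_cvg0.
- apply: filterS small_mesh => n hn.
  apply: (le_trans (ou_martingale_moment bmW theta0 T0 n.+1 hn)).
  rewrite lee_fin mulrDr mulrA meshM expr2 -mulrA mulrA meshM.
  have th : 0 < - theta by rewrite oppr_gt0.
  have : mesh T n / 2 <= (- theta)^-1 by have := mesh_gt0 n T0; lra.
  move=> h; have := ler_wpM2l (ltW T0) h.
  lra.
Qed.

End ou_tails.

(** * Smallness and tightness in probability *)

Section in_probability.
Context {d : measure_display} {Omega : measurableType d} {R : realType}.
Variable P : probability Omega R.
Implicit Types (Q : R -> Omega -> Prop) (Y Z : R -> Omega -> R).

(** An exceptional event, instead of the probability of the set where [Q T]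
    fails, makes measurability of [Q T] irrelevant and absorbs null sets. *)
Definition likely (e : R) Q := \forall T \near +oo, exists E : set Omega,
  [/\ measurable E, (P E <= e%:E)%E & forall w, ~ E w -> Q T w].

Definition small Y := forall e, 0 < e -> likely e (fun T w => `|Y T w| <= e).
Definition tight Y := forall e, 0 < e -> exists M, likely e (fun T w => `|Y T w| <= M).
(** Tightness of the inverse, stated so as to exclude the value 0, at which the
    field inverse is 0 too. *)
Definition away Y := forall e, 0 < e ->
  exists2 m, 0 < m & likely e (fun T w => m <= `|Y T w|).

Lemma likelyS e Q1 Q2 : (forall T w, Q1 T w -> Q2 T w) -> likely e Q1 -> likely e Q2.
Proof.
move=> Q12; apply: filterS => T [E [mE PE hE]].
by exists E; split => // w /hE; exact: Q12.
Qed.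

Lemma likelyI e Q1 Q2 : likely (e / 2) Q1 -> likely (e / 2) Q2 ->
  likely e (fun T w => Q1 T w /\ Q2 T w).
Proof.
apply: filterS2 => T [E [mE PE hE]] [E' [mE' PE' hE']].
exists (E `|` E'); split; first exact: measurableU.
  apply: (@le_trans _ _ (P E + P E')%E); first exact: measureU2.
  by rewrite [e]splitr EFinD leeD.
by move=> w /not_orP[nE nE']; split; [exact: hE|exact: hE'].
Qed.

Lemma likely_le e e' Q : e <= e' -> likely e Q -> likely e' Q.
Proof.
move=> ee'; apply: filterS => T [E [mE PE hE]]; exists E; split => //.
by apply: (le_trans PE); rewrite lee_fin.
Qed.

Lemma likely_ae e Q : 0 < e ->
  (\forall T \near +oo, {ae P, forall w, Q T w}) -> likely e Q.
Proof.
move=> e0; apply: filterS => T [N [mN N0 hN]]; exists N; split => //.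
  by have -> : P N = 0%E := N0; rewrite lee_fin ltW.
by move=> w nN; apply: contrapT => h; apply: nN; exact: hN.
Qed.

Let half_gt0 (e : R) : 0 < e -> 0 < e / 2. Proof. by move=> e0; rewrite divr_gt0. Qed.

Lemma small_tight Y : small Y -> tight Y.
Proof. by move=> sY e e0; exists e; exact: sY. Qed.

Lemma small_dominated Y Z :
  (forall e, 0 < e -> likely e (fun T w => `|Y T w| <= `|Z T w|)) ->
  small Z -> small Y.
Proof.
move=> YZ sZ e e0; have e20 := half_gt0 e0.
apply: likelyS (likelyI (YZ _ e20) (sZ _ e20)) => T w [h1 h2].
by rewrite (le_trans h1)// (le_trans h2)// ler_pdivrMr// ler_pMr// ler1n.
Qed.

Lemma tight_dominated Y Z :
  (forall e, 0 < e -> likely e (fun T w => `|Y T w| <= `|Z T w|)) ->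
  tight Z -> tight Y.
Proof.
move=> YZ tZ e e0; have e20 := half_gt0 e0; have [M hM] := tZ _ e20.
exists M; apply: likelyS (likelyI (YZ _ e20) hM) => T w [h1 h2].
exact: le_trans h2.
Qed.

Lemma likely_eq Y Z : (\forall T \near +oo, {ae P, forall w, Y T w = Z T w}) ->
  forall e, 0 < e -> likely e (fun T w => `|Y T w| <= `|Z T w|).
Proof.
move=> YZ e e0; apply: likely_ae => //; apply: filterS YZ => T.
by apply: filterS => w ->.
Qed.

Lemma smallD Y Z : small Y -> small Z -> small (fun T w => Y T w + Z T w).
Proof.
move=> sY sZ e e0; have e20 := half_gt0 e0.
apply: likelyS (likelyI (sY _ e20) (sZ _ e20)) => T w [h1 h2].
by rewrite (le_trans (ler_normD _ _))// [leRHS]splitr lerD.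
Qed.

Lemma tightD Y Z : tight Y -> tight Z -> tight (fun T w => Y T w + Z T w).
Proof.
move=> tY tZ e e0; have e20 := half_gt0 e0.
have [M hM] := tY _ e20; have [N hN] := tZ _ e20; exists (M + N).
apply: likelyS (likelyI hM hN) => T w [h1 h2].
by rewrite (le_trans (ler_normD _ _))// lerD.
Qed.

Lemma tightM Y Z : tight Y -> tight Z -> tight (fun T w => Y T w * Z T w).
Proof.
move=> tY tZ e e0; have e20 := half_gt0 e0.
have [M hM] := tY _ e20; have [N hN] := tZ _ e20; exists (M * N).
by apply: likelyS (likelyI hM hN) => T w [h1 h2]; rewrite normrM ler_pM.
Qed.

Lemma smallM Y Z : small Y -> tight Z -> small (fun T w => Y T w * Z T w).
Proof.
move=> sY tZ e e0; have e20 := half_gt0 e0; have [M hM] := tZ _ e20.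
have M1 : 0 < `|M| + 1 by rewrite ltr_wpDl.
pose dl := Num.min (e / 2) (e / (`|M| + 1)).
have dl0 : 0 < dl by rewrite lt_min e20 divr_gt0.
have := sY _ dl0 => /(likely_le (e' := e / 2)); rewrite ge_min lexx => /(_ isT) hY.
apply: likelyS (likelyI hY hM) => T w [h1 h2].
rewrite normrM (@le_trans _ _ (e / (`|M| + 1) * (`|M| + 1)))//; last first.
  by rewrite divfK ?gt_eqF.
apply: ler_pM => //; first by rewrite (le_trans h1)// ge_min lexx orbT.
by rewrite (le_trans h2)// (le_trans (ler_norm _))// lerDl.
Qed.

Lemma tight_cst (k : R) : tight (fun _ _ => k).
Proof.
move=> e e0; exists `|k|; apply: nearW => T; exists set0; split => //.
by rewrite measure0 lee_fin ltW.
Qed.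

Lemma away_cst (k : R) : k != 0 -> away (fun _ _ => k).
Proof.
move=> k0 e e0; exists `|k|; rewrite ?normr_gt0//.
apply: nearW => T; exists set0; split => //.
by rewrite measure0 lee_fin ltW.
Qed.

Lemma tightV Y : away Y -> tight (fun T w => (Y T w)^-1).
Proof.
move=> aY e e0; have [m m0 hm] := aY _ e0; exists m^-1.
apply: likelyS hm => T w h; rewrite normfV lef_pV2// posrE//.
exact: lt_le_trans h.
Qed.

Lemma awayV Y : tight (fun T w => (Y T w)^-1) ->
  (\forall T \near +oo, {ae P, forall w, Y T w != 0}) -> away Y.
Proof.
move=> tY Y0 e e0; have e20 := half_gt0 e0; have [M hM] := tY _ e20.
have M1 : 0 < `|M| + 1 by rewrite ltr_wpDl.
exists (`|M| + 1)^-1; first by rewrite invr_gt0.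
apply: likelyS (likelyI hM (likely_ae e20 Y0)) => T w [h1 h2].
rewrite -[leRHS]invrK lef_pV2 ?posrE ?invr_gt0 ?normr_gt0//.
by rewrite -normfV (le_trans h1)// (le_trans (ler_norm _))// lerDl.
Qed.

Lemma away_small Y Z : away Y -> small (fun T w => Z T w - Y T w) -> away Z.
Proof.
move=> aY sZ e e0; have e20 := half_gt0 e0; have [m m0 hm] := aY _ e20.
exists (m / 2); first exact: half_gt0.
have dl0 : 0 < Num.min (e / 2) (m / 2) by rewrite lt_min e20 half_gt0.
have := sZ _ dl0 => /(likely_le (e' := e / 2)); rewrite ge_min lexx => /(_ isT) hZ.
apply: likelyS (likelyI hm hZ) => T w [h1]; rewrite le_min => /andP[_ h2].
have : `|Y T w| <= `|Z T w| + `|Z T w - Y T w|.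
  by rewrite -{1}[Y T w](subKr (Z T w)) (le_trans (ler_normB _ _)).
by move: h1 h2; lra.
Qed.

Lemma away_neq0 Y e : away Y -> 0 < e -> likely e (fun T w => Y T w != 0).
Proof.
move=> aY e0; have [m m0 hm] := aY _ e0; apply: likelyS hm => T w h.
by rewrite -normr_gt0 (lt_le_trans m0).
Qed.

(** A continuous [f] is uniformly continuous only on bounded sets, whence the
    tightness of [Z].  The common value [l] stands for convergence of [Z] in
    distribution: here its law is the same at all times. *)
Lemma slutsky Y Z (f : R -> R) (l : \bar R) :
  small (fun T w => Y T w - Z T w) -> tight Z ->
  (forall T, 0 < T -> measurable_fun [set: Omega] (Y T)) ->
  (forall T, 0 < T -> measurable_fun [set: Omega] (Z T)) ->
  continuous f -> bounded_fun f ->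
  (forall T, 0 < T -> 'E_P[f \o Z T]%E = l) ->
  ('E_P[f \o Y T])%E @[T --> +oo] --> l.
Proof.
move=> sYZ tZ mY mZ cf bf lE.
have [K K0 fK] : exists2 K, 0 < K & forall y, `|f y| <= K.
  have [M [_ hM]] := bf; exists (`|M| + 1); first by rewrite ltr_wpDl.
  by move=> y; apply: hM => //; rewrite (le_lt_trans (ler_norm _))// ltrDl.
have mf : measurable_fun [set: R] f by exact: continuous_measurable_fun.
have intf V : measurable_fun [set: Omega] V -> P.-integrable [set: Omega] (EFin \o (f \o V)).
  move=> mV; apply: (@le_integrable _ _ _ P _ _ _ (EFin \o cst K)) => //.
  - by apply/measurable_EFinP; exact: measurableT_comp.
  - by move=> w _ /=; rewrite lee_fin (le_trans (fK _))// ler_norm.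
  - exact: finite_measure_integrable_cst.
have bound (V V' : Omega -> R) (E : set Omega) (e p : R) :
    measurable_fun [set: Omega] V -> measurable_fun [set: Omega] V' ->
    measurable E -> (P E <= p%:E)%E -> 0 <= e ->
    (forall w, ~ E w -> `|f (V w) - f (V' w)| <= e) ->
    `|fine 'E_P[f \o V] - fine 'E_P[f \o V']| <= e + 2 * K * p.
  move=> mV mV' mE PE e0 hE.
  have K2 : 0 <= 2 * K by rewrite mulr_ge0// ltW.
  have iV := intf _ mV; have iV' := intf _ mV'.
  rewrite unlock -fineB; [|exact: integrable_fin_num|exact: integrable_fin_num].
  rewrite -integralB_EFin//.
  have iB : P.-integrable [set: Omega] (fun w => ((f \o V) w - (f \o V') w)%:E).
    exact: (integrableB measurableT iV iV').
  rewrite -lee_fin -abse_EFin fineK ?integrable_fin_num//.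
  apply: (le_trans (le_abse_integral _ _ _)) => //; first exact: (measurable_int _ iB).
  apply: (@le_trans _ _ (\int[P]_w (e%:E + (2 * K)%:E * (\1_E w)%:E))%E).
    apply: ge0_le_integral => //.
    - by apply: measurableT_comp => //; exact: (measurable_int _ iB).
    - apply: emeasurable_funD => //; apply: emeasurable_funM => //.
      by apply/measurable_EFinP; exact: measurable_indic.
    - move=> w _; rewrite abse_EFin -EFinM -EFinD lee_fin indicE.
      have [wE|/negP wE] := boolP (w \in E).
        rewrite mulr1 (le_trans (ler_normB _ _))//.
        have := fK (V w); have := fK (V' w); rewrite /=; lra.
      by rewrite mulr0 addr0 hE// => /mem_set.
  rewrite ge0_integralD//=; last 2 first.
  - by move=> w _; rewrite -EFinM lee_fin mulr_ge0.
  - apply: emeasurable_funM => //.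
    by apply/measurable_EFinP; exact: measurable_indic.
  rewrite integral_cst//.
  have PT : P [set: Omega] = 1%E := probability_setT P.
  rewrite [X in (e%:E * X)%E]PT mule1 EFinD leeD2l//.
  rewrite ge0_integralZl//; last by apply/measurable_EFinP; exact: measurable_indic.
  rewrite integral_indic// setIT [leRHS]EFinM lee_wpmul2l//.
have lfin : l \is a fin_num.
  rewrite -(lE 1 ltr01) unlock; apply: integrable_fin_num => //.
  exact: intf (mZ _ ltr01).
rewrite -(fineK lfin).
apply/fine_cvgP; split.
  exists 0; split => // T T0; rewrite unlock.
  by apply: integrable_fin_num => //; exact: intf (mY _ T0).
apply/cvgrPdist_le => e e0.
have e20 := half_gt0 e0.
have e1 : 0 < e / (4 * K) by rewrite divr_gt0// mulr_gt0.
have [M hM] := tZ _ (half_gt0 e1).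
have [dl dl0 hdl] := uniformly_continuous_segment (- M) M cf e20.
have mn0 : 0 < Num.min (e / (4 * K) / 2) (dl / 2) by rewrite lt_min !half_gt0.
have := sYZ _ mn0 => /(likely_le (e' := e / (4 * K) / 2)).
rewrite ge_min lexx => /(_ isT) hY.
have := likelyI hM hY; apply: filterS2; last by exact: (nbhs_pinfty_gt (num_real (0 : R))).
move=> T T0 [E [mE PE hE]].
rewrite -(lE T T0).
rewrite distrC (le_trans (bound _ _ E (e / 2) (e / (4 * K))
  (mY _ T0) (mZ _ T0) mE PE (ltW e20) _))//.
  move=> w /hE[h1]; rewrite le_min => /andP[_ h2].
  rewrite distrC ltW// hdl// -?ler_norml//.
  by rewrite distrC (le_lt_trans h2)// ltr_pdivrMr// ltr_pMr// ltr1n.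
rewrite le_eqVlt; apply/orP; left; apply/eqP; field.
by rewrite gt_eqF.
Qed.

End in_probability.

(** The test functions [min(|y| / n, 1)] dominate the indicator of [|y| >= n],
    and their means under the law of [Z'] tend to 0. *)
Lemma tight_of_same_law {d d' : measure_display} {Omega : measurableType d}
    {Omega' : measurableType d'} {R : realType} (P : probability Omega R)
    (P' : probability Omega' R) (Z : R -> Omega -> R) (Z' : Omega' -> R) :
  (forall T, 0 < T -> measurable_fun [set: Omega] (Z T)) ->
  measurable_fun [set: Omega'] Z' ->
  (forall T (f : R -> R), 0 < T -> continuous f -> bounded_fun f ->
    ('E_P[f \o Z T] = 'E_P'[f \o Z'])%E) ->
  tight P Z.
Proof.
move=> mZ mZ' ZZ' e e0.
pose g n (y : R) := Num.min (`|y| / n.+1%:R) 1.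
have cg n : continuous (g n).
  move=> y; apply: (@continuous_min R R (fun y => `|y| / n.+1%:R) (cst 1) y).
    by apply: cvgMl; exact: norm_continuous.
  exact: cvg_cst.
have g0 n y : 0 <= g n y by rewrite le_min ler01 divr_ge0.
have g1 n y : g n y <= 1 by rewrite ge_min lexx orbT.
have bg n : bounded_fun (g n).
  exists 1; split => // M M1 y _ /=.
  by rewrite ger0_norm// (le_trans (g1 n y))// ltW.
have mg n : measurable_fun [set: R] (g n) by exact: continuous_measurable_fun.
have lim0 : (\int[P']_w (g n (Z' w))%:E)%E @[n --> \oo] --> (0 : \bar R)%E.
  have := @dominated_convergence _ _ _ P' setT measurableT
    (fun n w => (g n (Z' w))%:E) (fun=> 0%E) (EFin \o cst 1).
  case => //.
  - by move=> n; apply/measurable_EFinP; exact: measurableT_comp.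
  - apply: aeW => w _; apply: cvg_EFin; first exact: nearW.
    have h : `|Z' w| / n.+1%:R @[n --> \oo] --> (0 : R).
      by rewrite -[X in _ --> X](mulr0 `|Z' w|); apply: cvgMr; exact: cvg_harmonic.
    apply: (@squeeze_cvgr _ _ _ _ (fun=> 0) (fun n => `|Z' w| / n.+1%:R)) => //;
      last exact: cvg_cst.
    by apply: nearW => n; rewrite g0 /g ge_min lexx.
  - exact: finite_measure_integrable_cst.
  - by apply: aeW => w n _; rewrite /= lee_fin ger0_norm.
  - by rewrite integral0.
have [n hn] : exists n, (\int[P']_w (g n (Z' w))%:E <= e%:E)%E.
  apply: contrapT => /forallNP h.
  have : (e%:E <= 0)%E.
    apply: (cvge_ge _ lim0); apply: nearW => n.
    by have /negP := h n; rewrite -ltNge => /ltW.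
  by rewrite lee_fin leNgt e0.
exists n.+1%:R.
apply: filterS (nbhs_pinfty_gt (num_real (0 : R))) => T T0.
have mgZ : measurable_fun [set: Omega] (fun w => (g n (Z T w))%:E).
  by apply/measurable_EFinP; apply: measurableT_comp => //; exact: mZ.
exists ([set: Omega] `&` [set w | (1%:E <= `|(g n (Z T w))%:E|)%E]); split.
- by apply: emeasurable_fun_c_infty => //; exact: measurableT_comp.
- have := @le_integral_abse _ _ _ P setT measurableT _ 1 mgZ ltr01.
  rewrite mul1e => /le_trans; apply.
  rewrite (eq_integral (fun w => (g n (Z T w))%:E)); last first.
    by move=> w _; rewrite gee0_abs// lee_fin.
  have := ZZ' T (g n) T0 (cg n) (bg n); rewrite unlock => h.
  by rewrite [leLHS]h.
- move=> w hw; rewrite leNgt; apply/negP => h; apply: hw; split => //=.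
  by rewrite lee_fin ger0_norm// /g le_min lexx andbT ler_pdivlMr// mul1r ltW.
Qed.

(** * Functionals of the rescaled Brownian path *)

(** The inverse is continuous off 0, and a single point is harmless. *)
Lemma measurable_inv {R : realType} : measurable_fun [set: R] (fun x : R => x^-1).
Proof.
rewrite -(setvU [set 0]); apply/measurable_funU => //.
  exact: measurableC.
split; last exact: measurable_fun_set1.
apply: open_continuous_measurable_fun.
  by apply: closed_openC; exact: closed_eq.
move=> x; rewrite inE/= => /eqP x0; exact: inv_continuous.
Qed.

Section brownian_functional.
Context {d d' : measure_display} {Omega : measurableType d}
  {Omega' : measurableType d'} {R : realType}.
Variables (P : probability Omega R) (P' : probability Omega' R).
Variables (W : process P) (B : process P').
Hypotheses (bmW : standard_brownian_motion W) (bmB : standard_brownian_motion B).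
Variable phi : R * R -> R.
Hypothesis mphi : measurable_fun setT phi.
Hypothesis cphi : forall u v, 0 < v -> {for (u, v), continuous phi}.

Lemma measurable_functional dd (O : measurableType dd) (Q : probability O R)
    (V : process Q) T : standard_brownian_motion V -> 0 < T ->
  measurable_fun [set: O] (fun w => phi (end_value V T w, square_mean V T w)).
Proof.
move=> bmV T0; apply: measurableT_comp => //.
apply: measurable_fun_pair; first exact: measurable_end_value.
exact: measurable_square_mean.
Qed.

Lemma functional_law T (f : R -> R) : 0 < T -> continuous f -> bounded_fun f ->
  ('E_P[f \o (fun w => phi (end_value W T w, square_mean W T w))] =
   'E_P'[f \o (fun w => phi (end_value B 1 w, square_mean B 1 w))])%E.
Proof.
move=> T0 cf bf; rewrite unlock.
have [M [_ hM]] := bf.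
apply: (@brownian_functional_law _ _ _ _ _ P P' W B T 1 (f \o phi) (`|M| + 1)) => //.
- by apply: measurableT_comp => //; exact: continuous_measurable_fun.
- by move=> z; apply: hM => //; rewrite (le_lt_trans (ler_norm _))// ltrDl.
- by move=> u v v0; apply: continuous_comp; [exact: cphi|exact: cf].
Qed.

(** Tightness is inherited from the fixed law of the functional of [B]. *)
Lemma functional_tight : tight P (fun T w => phi (end_value W T w, square_mean W T w)).
Proof.
apply: tight_of_same_law.
- by move=> T T0; exact: measurable_functional.
- by apply: (measurable_functional bmB).
- by move=> T f T0 cf bf; exact: functional_law.
Qed.

End brownian_functional.

(** * Consistency, and the residual path at the diffusive scale *)

Section consistency.
Context {d d' : measure_display} {Omega : measurableType d}
  {Omega' : measurableType d'} {R : realType}.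
Variables (P : probability Omega R) (P' : probability Omega' R).
Variables (W X : process P) (B : process P').
Hypotheses (bmW : standard_brownian_motion W) (bmB : standard_brownian_motion B).
Hypothesis cX : continuous_paths X.
Variable theta : R.
Hypotheses (theta0 : theta < 0).
Hypothesis X_ou : {ae P, forall w, forall t, 0 <= t ->
  X t w = theta * time_integral (sample_path X w) t + increment W 0 t w}.

Let Xend T w := X T w / Num.sqrt T.
Let energy T w := time_integral (fun t => X t w ^+ 2) T.
Let mean_energy T w := energy T w / T.
(** The martingale [\int_0^T X dW] divided by [T], in the form given by the Ito
    formula. *)
Let martingale_mean T w := (X T w ^+ 2 - T - 2 * theta * energy T w) / 2 / T.

Let nth0 : 0 < - theta. Proof. by rewrite oppr_gt0. Qed.

Let near_gt0 : \forall T \near +oo, 0 < (T : R).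
Proof. exact: (nbhs_pinfty_gt (num_real (0 : R))). Qed.

Let tail_small (C e T : R) : 0 < C -> 0 < e -> 0 < T -> C / e ^+ 3 <= T ->
  C / (e ^+ 2 * T) <= e.
Proof.
move=> C0 e0 T0; rewrite !ler_pdivrMr ?exprn_gt0// ?mulr_gt0 ?exprn_gt0//.
by move=> h; apply: (le_trans h); rewrite le_eqVlt; apply/orP; left; apply/eqP; ring.
Qed.

Lemma small_Xend : small P Xend.
Proof.
move=> e e0; have C0 : 0 < (- theta)^-1 by rewrite invr_gt0.
apply: filterS2 near_gt0 (nbhs_pinfty_ge (num_real ((- theta)^-1 / e ^+ 3))) => T T0 Tbig.
have sT0 : 0 < Num.sqrt T by rewrite sqrtr_gt0.
have [E [mE PE hE]] := ou_endpoint_tail bmW cX theta0 T0 X_ou (mulr_gt0 e0 sT0).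
exists E; split => //.
  apply: (le_trans PE); rewrite lee_fin exprMn (sqr_sqrtr (ltW T0)).
  exact: tail_small.
by move=> w /hE h; rewrite normrM normfV (ger0_norm (ltW sT0)) ler_pdivrMr.
Qed.

Lemma small_martingale_mean : small P martingale_mean.
Proof.
move=> e e0; have C0 : 0 < 2 / - theta by rewrite divr_gt0.
apply: filterS2 near_gt0 (nbhs_pinfty_ge (num_real (2 / - theta / e ^+ 3))) => T T0 Tbig.
have [E [mE PE hE]] := ou_martingale_tail bmW cX theta0 T0 X_ou (mulr_gt0 e0 T0).
exists E; split => //.
  apply: (le_trans PE); rewrite lee_fin.
  rewrite [leLHS](_ : _ = 2 / - theta / (e ^+ 2 * T)); first exact: tail_small.
  by field; rewrite (gt_eqF T0) (gt_eqF e0) (lt_eqF theta0).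
by move=> w /hE h; rewrite normrM normfV (ger0_norm (ltW T0)) ler_pdivrMr.
Qed.

Let c0 : R := (- (2 * theta))^-1.

(** By definition of [martingale_mean], the difference equals
    [(X_T^2 / T - 2 martingale_mean) / (2 theta)]. *)
Lemma small_mean_energy : small P (fun T w => mean_energy T w - c0).
Proof.
have tx := small_tight small_Xend.
have s1 : small P (fun T w => Xend T w * Xend T w * (2 * theta)^-1).
  exact: smallM (smallM small_Xend tx) (tight_cst _ _).
have s2 : small P (fun T w => martingale_mean T w * - theta^-1).
  exact: smallM small_martingale_mean (tight_cst _ _).
apply: small_dominated (smallD s1 s2); apply: likely_eq.
apply: filterS near_gt0 => T T0; apply: aeW => w.
rewrite /martingale_mean /Xend /c0 /mean_energy; move: (energy T w) => J.
have -> : X T w / Num.sqrt T * (X T w / Num.sqrt T) = X T w ^+ 2 / T.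
  by rewrite -expr2 exprMn exprVn (sqr_sqrtr (ltW T0)).
have tn : theta != 0 by rewrite lt_eqF.
have Tn : T != 0 by rewrite gt_eqF.
by field; rewrite tn Tn.
Qed.

Lemma away_mean_energy : away P mean_energy.
Proof.
apply: away_small small_mean_energy; apply: away_cst.
by rewrite invr_eq0 oppr_eq0 mulf_eq0 pnatr_eq0 (lt_eqF theta0).
Qed.

Lemma tight_mean_energy : tight P mean_energy.
Proof.
have := tightD (small_tight small_mean_energy) (tight_cst P c0).
by apply: tight_dominated; apply: likely_eq; apply: nearW => T; apply: aeW => w; rewrite subrK.
Qed.

(** The weight of [X] in the residual path, which is [1 - theta_hat / theta]
    where [mean_energy] does not vanish. *)
Let coef T w := - martingale_mean T w * (theta * mean_energy T w)^-1.

Lemma small_coef : small P coef.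
Proof.
have := smallM (smallM small_martingale_mean (tight_cst P (- theta^-1))) (tightV away_mean_energy).
apply: small_dominated; apply: likely_eq; apply: nearW => T; apply: aeW => w.
by rewrite /coef invfM mulrA mulNr mulrN.
Qed.

Lemma theta_hat_coef T w : 0 < T -> mean_energy T w != 0 ->
  theta_hat (sample_path X w) T = theta * (1 - coef T w).
Proof.
move=> T0 E0.
have tn : theta != 0 by rewrite lt_eqF.
have Tn : T != 0 by rewrite gt_eqF.
have En : energy T w != 0 by apply: contra E0 => /eqP h; rewrite /mean_energy h mul0r.
rewrite /theta_hat /coef /martingale_mean /mean_energy /sample_path -/(energy T w).
move: (energy T w) En => J Jn.
by field; rewrite tn Tn Jn.
Qed.

Let U T w := end_value W T w.
Let D T w := square_mean W T w.

Let tightU : tight P U.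
Proof.
apply: (functional_tight bmW bmB (phi := fst)); first exact: measurable_fst.
by move=> u v _; exact: cvg_fst.
Qed.

Let tight_sqmean : tight P D.
Proof.
apply: (functional_tight bmW bmB (phi := snd)); first exact: measurable_snd.
by move=> u v _; exact: cvg_snd.
Qed.

Let away_sqmean : away P D.
Proof.
apply: awayV.
  apply: (functional_tight bmW bmB (phi := fun z => z.2^-1)).
    by apply: measurableT_comp; [exact: measurable_inv|exact: measurable_snd].
  by move=> u v v0; apply: cvgV; [rewrite gt_eqF|exact: cvg_snd].
apply: filterS near_gt0 => T T0; apply: filterS (end_value_neq0 bmW T0) => w.
by move=> /(square_mean_gt0 bmW T0) h; rewrite gt_eqF.
Qed.

Let cross T w := time_integral (fun t => increment W 0 t w * X t w) T / T ^+ 2.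

Let xe w (t : R) := X (Num.max 0 t) w.

Let cxe w : continuous (xe w).
Proof. exact: continuous_extended_path. Qed.

Let bxE w t : 0 <= t -> centered_path W w t = increment W 0 t w.
Proof. by move=> t0; rewrite /centered_path max_r. Qed.

Let xeE w t : 0 <= t -> xe w t = X t w.
Proof. by move=> t0; rewrite /xe max_r. Qed.

Let cbx w : continuous (centered_path W w).
Proof. exact: continuous_centered_path. Qed.

Let energyE T w : energy T w = time_integral (fun t => xe w t ^+ 2) T.
Proof. by apply: time_integral_extend => t t0; rewrite xeE. Qed.

Let crossE T w : cross T w =
  time_integral (fun t => centered_path W w t * xe w t) T / T ^+ 2.
Proof. by congr (_ / _); apply: time_integral_extend => t t0; rewrite xeE// bxE. Qed.

Let sqmeanE T w : D T w =
  time_integral (fun t => centered_path W w t ^+ 2) T / T ^+ 2.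
Proof. by congr (_ / _); apply: time_integral_extend => t t0; rewrite bxE. Qed.

Let tight_mean_energy_div : tight P (fun T w => mean_energy T w / T).
Proof.
apply: tight_dominated tight_mean_energy => e e_0; apply: likely_ae => //.
apply: filterS (nbhs_pinfty_ge (num_real (1 : R))) => T T1; apply: aeW => w.
have T0 : 0 < T by rewrite (lt_le_trans ltr01).
by rewrite normrM ler_piMr// normfV (ger0_norm (ltW T0)) invf_le1.
Qed.

(** The mixed term is controlled by the two squares. *)
Let tight_cross : tight P cross.
Proof.
apply: tight_dominated (tightD tight_sqmean tight_mean_energy_div).
move=> e e_0; apply: likely_ae => //; apply: filterS near_gt0 => T T0; apply: aeW => w.
have D0 : 0 <= D T w.
  by rewrite sqmeanE divr_ge0 ?time_integral_ge0// => *; exact: sqr_ge0.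
have E0 : 0 <= energy T w by apply: time_integral_ge0 => *; exact: sqr_ge0.
have T20 : 0 < T ^+ 2 by rewrite exprn_gt0.
rewrite [leRHS]ger0_norm; last first.
  by rewrite addr_ge0// /mean_energy !divr_ge0// ltW.
rewrite crossE normrM normfV (ger0_norm (ltW T20)) sqmeanE.
rewrite [leRHS](_ : _ = (time_integral (fun t => centered_path W w t ^+ 2) T
  + energy T w) / T ^+ 2); last by rewrite /mean_energy; field; rewrite gt_eqF.
rewrite energyE ler_wpM2r ?invr_ge0 ?(ltW T20)//.
exact: time_integral_product_le.
Qed.

Let p T w := V_hat (sample_path X w) T T / Num.sqrt T.
Let q T w := time_integral (fun t => V_hat (sample_path X w) T t ^+ 2) T / T ^+ 2.

Let ou_path w := forall t, 0 <= t ->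
  X t w = theta * time_integral (sample_path X w) t + increment W 0 t w.

Let likely_regular e : 0 < e ->
  likely P e (fun T w => (0 < T /\ ou_path w) /\ mean_energy T w != 0).
Proof.
move=> e0; have e20 : 0 < e / 2 by rewrite divr_gt0.
apply: likelyI; last exact: away_neq0 away_mean_energy e20.
apply: likely_ae => //; apply: filterS near_gt0 => T T0.
by apply: filterS X_ou => w h; split.
Qed.

(** The equation expresses [theta * time_integral X] as [X - W]. *)
Let V_hatE T w t : 0 < T -> mean_energy T w != 0 -> ou_path w -> 0 <= t ->
  V_hat (sample_path X w) T t =
  (1 - coef T w) * increment W 0 t w + coef T w * X t w.
Proof.
move=> T0 E0 ou t0; rewrite /V_hat theta_hat_coef// -mulrA mulrCA /sample_path.
have <- : X t w - increment W 0 t w = theta * time_integral (sample_path X w) t.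
  by rewrite ou// addrK.
by ring.
Qed.

Let pE T w : 0 < T -> mean_energy T w != 0 -> ou_path w ->
  p T w = (1 - coef T w) * U T w + coef T w * Xend T w.
Proof.
move=> T0 E0 ou; rewrite /p V_hatE ?(ltW T0)// /U /end_value /Xend; ring.
Qed.

Let qE T w : 0 < T -> mean_energy T w != 0 -> ou_path w ->
  q T w = (1 - coef T w) ^+ 2 * D T w + 2 * (1 - coef T w) * coef T w * cross T w
    + coef T w ^+ 2 * (mean_energy T w / T).
Proof.
move=> T0 E0 ou; rewrite /q.
have -> : time_integral (fun t => V_hat (sample_path X w) T t ^+ 2) T =
      time_integral (fun t =>
        ((1 - coef T w) * centered_path W w t + coef T w * xe w t) ^+ 2) T.
  by apply: time_integral_extend => t t0; rewrite V_hatE// bxE// xeE.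
rewrite time_integral_quadratic// crossE sqmeanE /mean_energy energyE.
by field; rewrite gt_eqF.
Qed.

(** [p - U = coef * (Xend - U)]. *)
Let small_pU : small P (fun T w => p T w - U T w).
Proof.
have t1 : tight P (fun T w => Xend T w + -1 * U T w).
  exact: tightD (small_tight small_Xend) (tightM (tight_cst _ _) tightU).
apply: small_dominated (smallM small_coef t1) => e e0.
apply: likelyS (likely_regular e0) => T w [[T0 ou] E0].
rewrite pE// le_eqVlt; apply/orP; left; apply/eqP; congr (`|_|); ring.
Qed.

(** Every term of [q - D] carries a factor [coef]. *)
Let small_qD : small P (fun T w => q T w - D T w).
Proof.
have tc := small_tight small_coef.
have t1 : tight P (fun T w => (coef T w + -2) * D T w).
  exact: tightM (tightD tc (tight_cst _ _)) tight_sqmean.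
have t2 : tight P (fun T w => 2 * (1 + -1 * coef T w) * cross T w).
  apply: tightM tight_cross; apply: tightM (tight_cst _ _) _.
  exact: tightD (tight_cst _ _) (tightM (tight_cst _ _) tc).
have t3 : tight P (fun T w => coef T w * (mean_energy T w / T)).
  exact: tightM tc tight_mean_energy_div.
apply: small_dominated (smallM small_coef (tightD (tightD t1 t2) t3)) => e e0.
apply: likelyS (likely_regular e0) => T w [[T0 ou] E0].
rewrite qE// le_eqVlt; apply/orP; left; apply/eqP; congr (`|_|); ring.
Qed.

Let away_q : away P q.
Proof. exact: away_small away_sqmean small_qD. Qed.

Let rho_hatE T w : 0 < T ->
  T * rho_hat (sample_path X w) T = (p T w ^+ 2 - 1) / (2 * q T w).
Proof.
move=> T0; rewrite /rho_hat /p /q exprMn exprVn (sqr_sqrtr (ltW T0)).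
move: (V_hat _ _ _) (time_integral _ _) => v J.
have Tn : T != 0 by rewrite gt_eqF.
have [->|Jn] := eqVneq J 0; first by rewrite !(mul0r, mulr0, invr0).
by field; rewrite Tn Jn.
Qed.

(** With [p], [q] in place of [U], [D], the difference of the two ratios is
    [(p - U) (p + U) / (2 q) + (q - D) (1 - U^2) / (2 q D)]. *)
Lemma small_rho_hat : small P (fun T w =>
  T * rho_hat (sample_path X w) T - (U T w ^+ 2 - 1) / (2 * D T w)).
Proof.
have tp : tight P p.
  have := tightD (small_tight small_pU) tightU.
  by apply: tight_dominated; apply: likely_eq; apply: nearW => T; apply: aeW => w; rewrite subrK.
have tq := tightV away_q; have tD := tightV away_sqmean.
have s1 : small P (fun T w => (p T w - U T w) * ((p T w + U T w) * ((q T w)^-1 * 2^-1))).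
  apply: smallM small_pU (tightM (tightD tp tightU) (tightM tq (tight_cst _ _))).
have s2 : small P (fun T w => (q T w - D T w) *
    ((1 + -1 * (U T w * U T w)) * ((q T w)^-1 * ((D T w)^-1 * 2^-1)))).
  apply: smallM small_qD (tightM _ (tightM tq (tightM tD (tight_cst _ _)))).
  exact: tightD (tight_cst _ _) (tightM (tight_cst _ _) (tightM tightU tightU)).
apply: small_dominated (smallD s1 s2) => e e0.
have e20 : 0 < e / 2 by rewrite divr_gt0.
have e40 : 0 < e / 2 / 2 by rewrite divr_gt0.
have hqD := likelyI (away_neq0 away_q e40) (away_neq0 away_sqmean e40).
apply: likelyS (likelyI (likely_regular e20) hqD) => T w [[[T0 _] _] [q0 D0]].
rewrite rho_hatE// le_eqVlt; apply/orP; left; apply/eqP; congr (`|_|).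
move: (p T w) (U T w) (q T w) (D T w) q0 D0 => p' U' q' D' q0 D0.
by field; rewrite q0 D0.
Qed.

End consistency.

(** * Convergence in distribution *)

Section measurability.
Context {d : measure_display} {Omega : measurableType d} {R : realType}.
Variables (P : probability Omega R) (X : process P).
Hypothesis cX : continuous_paths X.

Let mX t : measurable_fun [set: Omega] (X t).
Proof. exact: measurable_funP. Qed.

Let measurable_square_integral (Y : R -> Omega -> R) (T : R) : 0 <= T ->
  (forall t, 0 <= t -> measurable_fun [set: Omega] (Y t)) ->
  (forall w, continuous (fun t : R => Y (Num.max 0 t) w)) ->
  measurable_fun [set: Omega] (fun w => time_integral (fun t => Y t w ^+ 2) T).
Proof.
move=> T0 mY cY; apply: (measurable_time_integral (Y := fun t w => Y t w ^+ 2)) => //.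
  by move=> t t0; apply: measurable_funX; exact: mY.
by move=> w; exact: (continuous_square (cY w)).
Qed.

Lemma measurable_theta_hat T : 0 <= T ->
  measurable_fun [set: Omega] (fun w => theta_hat (sample_path X w) T).
Proof.
move=> T0; apply: measurable_funM.
  by apply: measurable_funB => //; exact: measurable_funX.
apply: (measurableT_comp measurable_inv); apply: measurable_funM => //.
apply: measurable_square_integral => // w; exact: continuous_extended_path.
Qed.

Lemma measurable_V_hat T t : 0 <= T -> 0 <= t ->
  measurable_fun [set: Omega] (fun w => V_hat (sample_path X w) T t).
Proof.
move=> T0 t0; apply: measurable_funB => //; apply: measurable_funM.
  exact: measurable_theta_hat.
apply: measurable_time_integral => // w; exact: continuous_extended_path.
Qed.

Lemma continuous_V_hat T w :
  continuous (fun t : R => V_hat (sample_path X w) T (Num.max 0 t)).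
Proof.
have c1 := @continuous_extended_path _ _ _ _ X w cX.
have c2 := continuous_time_integral c1.
move=> t; rewrite /V_hat.
have c3 : (fun t : R => time_integral (sample_path X w) (Num.max 0 t)) =
    (fun t => time_integral (fun s => X (Num.max 0 s) w) (Num.max 0 t)).
  by apply/funext => s; apply: time_integral_extend => r r0; rewrite max_r.
have c4 : continuous (fun t : R => time_integral (sample_path X w) (Num.max 0 t)).
  by rewrite c3.
exact: (cvgB (c1 t) (cvgM (cvg_cst (theta_hat (sample_path X w) T)) (c4 t))).
Qed.

Lemma measurable_rho_hat T : 0 <= T ->
  measurable_fun [set: Omega] (fun w => rho_hat (sample_path X w) T).
Proof.
move=> T0; apply: measurable_funM.
  by apply: measurable_funB => //; apply: measurable_funX; exact: measurable_V_hat.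
apply: (measurableT_comp measurable_inv); apply: measurable_funM => //.
apply: (measurable_square_integral (Y := fun t w => V_hat (sample_path X w) T t)) => //.
  by move=> t t0; exact: measurable_V_hat.
by move=> w; exact: continuous_V_hat.
Qed.

End measurability.

(** The Dickey-Fuller functional of (endpoint, integrated square). *)
Definition unit_root_ratio {R : realType} (z : R * R) : R := (z.1 ^+ 2 - 1) / (2 * z.2).

Lemma measurable_unit_root_ratio {R : realType} :
  measurable_fun setT (@unit_root_ratio R).
Proof.
apply: measurable_funM.
  by apply: measurable_funB => //; apply: measurable_funX; exact: measurable_fst.
apply: (measurableT_comp measurable_inv); apply: measurable_funM => //.
Qed.

Lemma continuous_unit_root_ratio {R : realType} (u v : R) : 0 < v ->
  {for (u, v), continuous (@unit_root_ratio R)}.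
Proof.
move=> v0; apply: cvgM; last first.
  by apply: cvgV; [rewrite mulf_neq0 ?pnatr_eq0 ?gt_eqF|apply: cvgMr; exact: cvg_snd].
apply: cvgB; last exact: cvg_cst.
apply: (@continuous_comp _ _ _ fst (fun x : R => x ^+ 2)); first exact: cvg_fst.
exact: exprn_continuous.
Qed.

Theorem theorem3p3 (R : realType)
    (d : measure_display) (Omega : measurableType d) (P : probability Omega R)
    (d' : measure_display) (Omega' : measurableType d')
    (P' : probability Omega' R)
    (theta rho : R) (W V X : process P) (B : process P')
    (theta_lt0 : theta < 0) (rho_eq0 : rho = 0)
    (W_brownian : standard_brownian_motion W)
    (V_sde : solves_linear_sde rho W V)
    (X_sde : solves_linear_sde theta V X)
    (B_brownian : standard_brownian_motion B) :
  cvg_in_distribution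
    P (fun T w => T * rho_hat (sample_path X w) T)
    P' (fun w => (B 1 w ^+ 2 - 1) /
                 (2 * time_integral (fun s => B s w ^+ 2) 1)).
Proof.
have cX := sde_continuous X_sde.
have X_ou : {ae P, forall w, forall t, 0 <= t ->
    X t w = theta * time_integral (sample_path X w) t + increment W 0 t w}.
  apply: filterS3 (sde_start X_sde) (sde_equation X_sde) (sde_equation V_sde).
  move=> w X0 XE VE t t0; rewrite XE// X0 add0r; congr (_ + _).
  by rewrite [LHS]/increment (VE t t0) rho_eq0 mul0r; ring.
have mY T : 0 < T ->
    measurable_fun [set: Omega] (fun w => T * rho_hat (sample_path X w) T).
  move=> T0.
  have mr := measurable_rho_hat cX (ltW T0).
  exact: (measurable_funM (measurable_cst T) mr).
pose Zlim w := (B 1 w ^+ 2 - 1) / (2 * time_integral (fun s => B s w ^+ 2) 1).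
have mZ : measurable_fun [set: Omega'] Zlim.
  apply: measurable_funM.
    by apply: measurable_funB => //; apply: measurable_funX; exact: measurable_funP.
  apply: (measurableT_comp measurable_inv); apply: measurable_funM => //.
  apply: (measurable_time_integral (Y := fun t w => B t w ^+ 2)) => //.
    by move=> t t0; apply: measurable_funX; exact: measurable_funP.
  move=> w; apply: (@continuous_square _ (fun t => B (Num.max 0 t) w)).
  exact: continuous_extended_path (sbm_continuous B_brownian).
split => // f cf bf.
pose Z T w := unit_root_ratio (end_value W T w, square_mean W T w).
have mf : measurable_fun [set: R] f by exact: continuous_measurable_fun.
have lawZ T : 0 < T -> ('E_P[f \o Z T] = 'E_P'[f \o Zlim])%E.
  move=> T0.
  have -> := functional_law W_brownian B_brownian measurable_unit_root_ratio
    continuous_unit_root_ratio T0 cf bf.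
  rewrite unlock; apply: ae_eq_integral => //.
  - apply/measurable_EFinP; apply: measurableT_comp => //.
    exact: (measurable_functional measurable_unit_root_ratio B_brownian).
  - by apply/measurable_EFinP; apply: measurableT_comp.
  - apply: filterS (sbm_start B_brownian) => w B0 _; congr (f _)%:E.
    rewrite /unit_root_ratio /end_value /square_mean /= sqrtr1 expr1n !divr1.
    rewrite /increment B0 subr0; congr (_ / (_ * _)).
    by apply: time_integral_extend => s _; rewrite subr0.
apply: (@slutsky _ _ _ P _ Z) => //.
- exact: (small_rho_hat W_brownian B_brownian cX theta_lt0 X_ou).
- exact: (functional_tight W_brownian B_brownian
    measurable_unit_root_ratio continuous_unit_root_ratio).
- by move=> T T0; exact: (measurable_functional measurable_unit_root_ratio W_brownian).
Qed.
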